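(* For every even $n$, there is a simple polygon $P$ with $n$ vertices that has $2^{\Omega(n)}$ combinatorially distinct Aleksandrov gluings.
   Context: A gluing of a polygon $P$ is a length-preserving identification of $\partial P$ with itself (finitely many open intervals glued isometrically in pairs, endpoints identified, transitively). An Aleksandrov gluing is one where at most $2\pi$ total face angle is glued at any point and the result is homeomorphic to a sphere. Two gluings are combinatorially distinct when their gluing trees differ. The gluing tree of a gluing is the labeled tree that is the image of $\partial P$ after identification: its nodes are the images of points of $\partial P$ identified with more or fewer than one other distinct point, together with images of points to which a vertex of $P$ is glued; each node is labeled by the set of vertices and edges of $P$ glued there (a point interior to an edge glued only to itself is a leaf labeled by its edge). *)

(* Defs.v *)
From Stdlib Require Import Reals Lra List Arith Relations.
Open Scope R_scope.

Definition pt := (R * R)%type.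
Definition pt3 := (R * R * R)%type.

Definition dist (p q : pt) : R :=
  sqrt ((fst p - fst q)^2 + (snd p - snd q)^2).
Definition norm2 (p : pt) : R := sqrt (fst p ^2 + snd p ^2).
Definition dist3 (p q : pt3) : R :=
  sqrt ((fst (fst p) - fst (fst q))^2 + (snd (fst p) - snd (fst q))^2
        + (snd p - snd q)^2).

Definition sphere2 (p : pt3) : Prop :=
  fst (fst p) ^2 + snd (fst p) ^2 + snd p ^2 = 1.

Section Polygon.
Variable n : nat.
Variable v : nat -> pt.

Definition V (i : nat) : pt := v (Nat.modulo i n).

Definition elen (i : nat) : R := dist (V i) (V (S i)).

Fixpoint cum (i : nat) : R :=
  match i with O => 0 | S j => cum j + elen j end.

Definition perimeter : R := cum n.

Definition rmod (s : R) : R := s - perimeter * IZR (Int_part (s / perimeter)).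

Definition interp (i : nat) (s : R) : pt :=
  let t := (s - cum i) / elen i in
  (fst (V i) + t * (fst (V (S i)) - fst (V i)),
   snd (V i) + t * (snd (V (S i)) - snd (V i))).

Fixpoint seg_pt (k i : nat) (s : R) : pt :=
  match k with
  | O => V 0
  | S k' => if Rle_dec s (cum (S i)) then interp i s else seg_pt k' (S i) s
  end.

Definition gamma (s : R) : pt := seg_pt n 0 (rmod s).

Definition on_boundary (p : pt) : Prop := exists s, gamma s = p.

Definition in_edge_interior (i : nat) (p : pt) : Prop :=
  exists s, cum i < s < cum (S i) /\ gamma s = p.

(** simple polygon with n vertices: n >= 3, consecutive vertices distinct,
    no three consecutive vertices collinear (so that all n are genuine corners),
    and the boundary curve is a simple closed curve (gamma injective on one period). *)
Definition cross (a b : pt) : R := fst a * snd b - snd a * fst b.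
Definition dot (a b : pt) : R := fst a * fst b + snd a * snd b.
Definition vsub (a b : pt) : pt := (fst a - fst b, snd a - snd b).

Definition simple_polygon : Prop :=
  (3 <= n)%nat /\
  (forall i, (i < n)%nat -> V i <> V (S i)) /\
  (forall i, (i < n)%nat -> cross (vsub (V (S i)) (V i)) (vsub (V (i + n - 1)) (V i)) <> 0) /\
  (forall s t, 0 <= s < perimeter -> 0 <= t < perimeter -> gamma s = gamma t -> s = t).

Fixpoint shoelace (k : nat) : R :=
  match k with O => 0 | S j => shoelace j + cross (V j) (V (S j)) end.

Definition ccw_angle (w u : pt) : R :=
  let c := acos (dot w u / (norm2 w * norm2 u)) in
  if Rle_dec 0 (cross w u) then c else 2 * PI - c.

Definition interior_angle (i : nat) : R :=
  let w := vsub (V (S i)) (V i) in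
  let u := vsub (V (i + n - 1)) (V i) in
  if Rlt_dec 0 (shoelace n) then ccw_angle w u else ccw_angle u w.

Definition face_angle (p : pt) : R :=
  match (fix find (k : nat) : option nat :=
           match k with
           | O => None
           | S j => match find j with
                    | Some i => Some i
                    | None => if (Req_dec_T (fst (V j)) (fst p)) then
                                if Req_dec_T (snd (V j)) (snd p) then Some j else None
                              else None
                    end
           end) n with
  | Some i => interior_angle i
  | None => PI
  end.

(** closed region bounded by P: points from which every continuous path
    to a point outside the disc containing all vertices meets the boundary *)
Definition cont_path (c : R -> pt) : Prop :=
  forall t, 0 <= t <= 1 -> forall eps, 0 < eps -> exists delta, 0 < delta /\
    forall t', 0 <= t' <= 1 -> Rabs (t' - t) < delta -> dist (c t') (c t) < eps.

Definition region (x : pt) : Prop :=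
  forall c : R -> pt, cont_path c -> c 0 = x ->
    (forall i, (i < n)%nat -> norm2 (V i) < norm2 (c 1)) ->
    exists t, 0 <= t <= 1 /\ on_boundary (c t).

(** * Gluings.
    A gluing is given by finitely many pairs of open boundary arcs
    (a, a+l) and (b, b+l) (arc-length parameters, mod perimeter) identified
    isometrically, by the orientation-reversing map a+u |-> b+l-u
    (flag [true]) or the orientation-preserving map a+u |-> b+u (flag [false]). *)
Definition glue_pair := (R * R * R * bool)%type.
Definition gluing := list glue_pair.

Definition gp_a (g : glue_pair) : R := fst (fst (fst g)).
Definition gp_b (g : glue_pair) : R := snd (fst (fst g)).
Definition gp_l (g : glue_pair) : R := snd (fst g).
Definition gp_rev (g : glue_pair) : bool := snd g.

Definition gp_image (g : glue_pair) (u : R) : R :=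
  if gp_rev g then gp_b g + gp_l g - u else gp_b g + u.

Definition arcs (G : gluing) : list (R * R) :=
  flat_map (fun g => (gp_a g, gp_l g) :: (gp_b g, gp_l g) :: nil) G.

Fixpoint sum_len (G : gluing) : R :=
  match G with nil => 0 | g :: G' => 2 * gp_l g + sum_len G' end.

(** well-formed gluing: positive lengths, the 2k open arcs are pairwise disjoint
    and their total length is the perimeter (so they cover the boundary up to
    finitely many points) *)
Definition is_gluing (G : gluing) : Prop :=
  (forall g, In g G -> 0 < gp_l g) /\
  (forall i j, (i < length (arcs G))%nat -> (j < length (arcs G))%nat -> i <> j ->
     forall u w,
       0 < u < snd (nth i (arcs G) (0,0)) -> 0 < w < snd (nth j (arcs G) (0,0)) ->
       gamma (fst (nth i (arcs G) (0,0)) + u) <> gamma (fst (nth j (arcs G) (0,0)) + w)) /\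
  sum_len G = perimeter.

Definition glue_step (G : gluing) (x y : pt) : Prop :=
  exists g, In g G /\ exists u, 0 <= u <= gp_l g /\
    x = gamma (gp_a g + u) /\ y = gamma (gp_image g u).

Definition glued (G : gluing) : relation pt := clos_refl_sym_trans pt (glue_step G).

Definition angle_condition (G : gluing) : Prop :=
  forall p (l : list pt), on_boundary p -> NoDup l ->
    (forall q, In q l -> glued G p q) ->
    fold_right Rplus 0 (map face_angle l) <= 2 * PI.

(** the result of the gluing (the closed region P with boundary points identified
    by [glued G]) is homeomorphic to the 2-sphere.  Since the region is compact and
    S^2 is Hausdorff, this is the same as a continuous surjection from the region
    onto S^2 whose fibres are exactly the identification classes. *)
Definition cont_on_region (h : pt -> pt3) : Prop :=
  forall x, region x -> forall eps, 0 < eps -> exists delta, 0 < delta /\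
    forall y, region y -> dist y x < delta -> dist3 (h y) (h x) < eps.

Definition sphere_result (G : gluing) : Prop :=
  exists h : pt -> pt3,
    cont_on_region h /\
    (forall x, region x -> sphere2 (h x)) /\
    (forall p, sphere2 p -> exists x, region x /\ h x = p) /\
    (forall x y, region x -> region y -> (h x = h y <-> glued G x y)).

Definition aleksandrov_gluing (G : gluing) : Prop :=
  is_gluing G /\ angle_condition G /\ sphere_result G.

Definition class_size_two (G : gluing) (p : pt) : Prop :=
  exists q, q <> p /\ glued G p q /\ forall r, glued G p r -> r = p \/ r = q.

(** p is (a representative of) a node of the gluing tree *)
Definition is_node (G : gluing) (p : pt) : Prop :=
  on_boundary p /\
  (~ class_size_two G p \/ exists i, (i < n)%nat /\ glued G p (V i)).

Definition tree_adj (G : gluing) (p q : pt) : Prop :=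
  exists s l, 0 < l /\ glued G (gamma s) p /\ glued G (gamma (s + l)) q /\
    forall u, 0 < u < l -> ~ is_node G (gamma (s + u)).

Definition label_vertex (G : gluing) (p : pt) (i : nat) : Prop := glued G p (V i).
Definition label_edge (G : gluing) (p : pt) (i : nat) : Prop :=
  exists q, in_edge_interior i q /\ glued G p q.

Definition same_gluing_tree (G1 G2 : gluing) : Prop :=
  exists phi : pt -> pt,
    (forall p, is_node G1 p -> is_node G2 (phi p)) /\
    (forall p q, is_node G1 p -> is_node G1 q ->
        (glued G1 p q <-> glued G2 (phi p) (phi q))) /\
    (forall q, is_node G2 q -> exists p, is_node G1 p /\ glued G2 (phi p) q) /\
    (forall p, is_node G1 p -> forall i, (i < n)%nat ->
        (label_vertex G1 p i <-> label_vertex G2 (phi p) i) /\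
        (label_edge G1 p i <-> label_edge G2 (phi p) i)) /\
    (forall p q, is_node G1 p -> is_node G1 q ->
        (tree_adj G1 p q <-> tree_adj G2 (phi p) (phi q))).

Definition combinatorially_distinct (G1 G2 : gluing) : Prop :=
  ~ same_gluing_tree G1 G2.

End Polygon.

(* Main.v *)
Require Import Defs.
From Stdlib Require Import Reals List Arith Lra Lia Relations ClassicalEpsilon Permutation.
From Coquelicot Require Import Coquelicot.
Open Scope R_scope.

(** The polygon is a star with [k = n/2] tips of angle [pi/k] and [k] reflex vertices of angle
    [2 pi - 3 pi/k], all edges having the same length, so that a reflex vertex and up to three
    tips may be glued together.  A plane tree with [n] edges of half the edge length gives a
    gluing of the boundary along its contour.  The trees used are caterpillars: in every group
    of four consecutive edges either the first or the last two are zipped up around the reflex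
    vertex between them, and the boundary that remains is folded in half.  The choices are
    independent and are read off from which tips get identified.

    Any contour gluing of a disc is a sphere.  Let [tau] be the contour function, so that the
    boundary points [s] and [s'] are identified when [tau s = tau s'] and [tau] does not go below
    this value in between.  The point at fraction [rho] of the radius through [s] is sent to the
    level [Y = rho tau(s) + (1 - rho) M] of the sphere, with [M] above the maximum of [tau], at
    longitude proportional to the integral of [max (0, Y - tau)] over [[0, s]].  Equal longitudes
    at one level force [tau >= Y] in between, hence [rho = 1] and an identified pair. *)

(** * Plane trees and their contours *)

(** The angles come from a budget. If a tip has angle [t] and a reflex vertex [2 pi - 3 t], then
    three tips and one reflex vertex fill a full turn exactly; the angle sum [(2 k - 2) pi] of a
    polygon with [k] vertices of each kind then forces [t = pi/k]. Two reflex vertices never fit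
    together, so folding the remaining boundary must match reflex vertices with tips. A fold about a
    vertex pairs vertices of equal kind, a fold about an edge midpoint pairs the two kinds. Hence
    tree edges are half polygon edges and both ends of the fold are midpoints. A zip uses up two
    whole edges, so it does not disturb this parity, whichever pair of edges is chosen; that is what
    makes the choices independent.

    On the sphere, the circle at level [Y] is made of the radii [s] with [tau s <= Y]. The open arcs
    with [tau > Y] are missing from it, but the two ends of such an arc are one point of the tree,
    so the circle closes up. An explicit map with known fibres replaces any appeal to the
    classification of surfaces, and only its continuity and its fibres have to be checked. *)

(** Plane trees through their contour words: [Leaf] is the empty word and [Node a b] is [U a D b],
    where [U] goes up and [D] goes down one edge. *)
Inductive tree := Leaf | Node (a b : tree).

(** Length of the contour word, so twice the number of tree edges: a polygon with [n] edges, cut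
    into [2 n] halves, needs a tree of size [2 n]. *)
Fixpoint size (t : tree) : nat :=
  match t with Leaf => 0%nat | Node a b => (2 + size a + size b)%nat end.

Notation rsize t := (INR (size t)).

Definition clamp01 (x : R) : R := Rmax 0 (Rmin 1 x).

(** Clamped ramps give one formula on all of [R]: the contour vanishes outside [[0, rsize t]], so
    the contours of subtrees can simply be shifted and added, and continuity follows summand by
    summand. *)
Fixpoint contour (t : tree) (s : R) : R :=
  match t with
  | Leaf => 0
  | Node a b => clamp01 s - clamp01 (s - 1 - rsize a)
             + contour a (s - 1) + contour b (s - 2 - rsize a)
  end.

Lemma clamp01_cases x :
  (x <= 0 /\ clamp01 x = 0) \/ (0 <= x <= 1 /\ clamp01 x = x) \/ (1 <= x /\ clamp01 x = 1).
Proof. unfold clamp01, Rmax, Rmin. destruct (Rle_dec 1 x), (Rle_dec 0 _); lra. Qed.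

Ltac clamp :=
  repeat match goal with |- context [clamp01 ?x] =>
    let e := fresh in let H := fresh in
    pose proof (clamp01_cases x) as H; set (e := clamp01 x) in *; clearbody e
  end; lra.

Lemma rsize_Node (a b : tree) : rsize (Node a b) = 2 + rsize a + rsize b.
Proof. change (size (Node a b)) with (2 + size a + size b)%nat. now rewrite !plus_INR. Qed.

Lemma rsize_ge0 (t : tree) : 0 <= rsize t.
Proof. apply pos_INR. Qed.

Lemma contour_out (t : tree) (s : R) : s <= 0 \/ rsize t <= s -> contour t s = 0.
Proof.
revert s; induction t as [|a IHa b IHb]; intros s; [reflexivity|].
rewrite rsize_Node; intros H.
pose proof (rsize_ge0 a); pose proof (rsize_ge0 b); cbn [contour].
rewrite IHa, IHb by lra. clamp.
Qed.

Section Pieces.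
Variables a b : tree.
Let Ha := rsize_ge0 a.

Lemma contour_up s : 0 <= s <= 1 -> contour (Node a b) s = s.
Proof. intros H; pose proof Ha; cbn [contour]; rewrite !contour_out by lra; clamp. Qed.

Lemma contour_child s : 1 <= s <= 1 + rsize a -> contour (Node a b) s = 1 + contour a (s - 1).
Proof. intros H; cbn [contour]; rewrite (contour_out b) by lra; clamp. Qed.

Lemma contour_down s :
  1 + rsize a <= s <= 2 + rsize a -> contour (Node a b) s = 2 + rsize a - s.
Proof. intros H; pose proof Ha; cbn [contour]; rewrite !contour_out by lra; clamp. Qed.

Lemma contour_next s :
  2 + rsize a <= s -> contour (Node a b) s = contour b (s - 2 - rsize a).
Proof. intros H; pose proof Ha; cbn [contour]; rewrite (contour_out a) by lra; clamp. Qed.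
End Pieces.

Lemma contour_ge0 (t : tree) (s : R) : 0 <= contour t s.
Proof.
revert s; induction t as [|a IHa b IHb]; intros s; [apply Rle_refl|].
pose proof (rsize_ge0 a); cbn [contour].
specialize (IHa (s - 1)); specialize (IHb (s - 2 - rsize a)).
enough (clamp01 (s - 1 - rsize a) <= clamp01 s) by lra. clamp.
Qed.

Lemma contour_le (t : tree) (s : R) : contour t s <= rsize t.
Proof.
revert s; induction t as [|a IHa b IHb]; intros s; [apply Rle_refl|].
pose proof (rsize_ge0 a); rewrite rsize_Node; cbn [contour].
specialize (IHa (s - 1)); specialize (IHb (s - 2 - rsize a)).
enough (clamp01 s <= 1 /\ 0 <= clamp01 (s - 1 - rsize a)) by lra. split; clamp.
Qed.

Lemma clamp01_continuous x : continuous clamp01 x.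
Proof.
apply (continuous_comp (fun x => Rmin 1 x) (fun y => Rmax 0 y)).
- apply (continuous_ext (fun x => (1 + x - Rabs (1 - x)) / 2)).
  { intros y. unfold Rmin, Rabs. destruct Rle_dec, Rcase_abs; lra. }
  apply continuity_pt_filterlim. apply continuity_pt_div; try reg; try lra.
- apply (continuous_ext (fun x => (0 + x + Rabs (0 - x)) / 2)).
  { intros y. unfold Rmax, Rabs. destruct Rle_dec, Rcase_abs; lra. }
  apply continuity_pt_filterlim. apply continuity_pt_div; try reg; try lra.
Qed.

Lemma contour_continuous (t : tree) (s : R) : continuous (contour t) s.
Proof.
revert s; induction t as [|a IHa b IHb]; intros s; cbn [contour].
- apply continuous_const.
- assert (S : forall (f : R -> R) (y : R), (forall z, continuous f z) ->
      continuous (fun s : R => f (s - y)) s).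
  { intros f y Hf. apply (continuous_comp (fun s => s - y) f); auto.
    apply (continuous_minus (V:=R_NormedModule)); [apply continuous_id|apply continuous_const]. }
  apply (continuous_plus (V:=R_NormedModule)); [apply (continuous_plus (V:=R_NormedModule));
    [apply (continuous_minus (V:=R_NormedModule))|]|].
  + apply clamp01_continuous.
  + apply (continuous_ext (fun s => clamp01 (s - (1 + rsize a)))).
    { intros y; f_equal; ring. } apply S, clamp01_continuous.
  + now apply S.
  + apply (continuous_ext (fun s => contour b (s - (2 + rsize a)))).
    { intros y; f_equal; ring. } now apply S.
Qed.

(** * Contour times that are one point of the tree *)

Definition same_point (f : R -> R) (s s' : R) : Prop :=
  f s = f s' /\ forall x, s <= x <= s' \/ s' <= x <= s -> f s <= f x.

Lemma same_point_refl f s : same_point f s s.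
Proof. split; [reflexivity|]. intros x H. replace x with s by lra. apply Rle_refl. Qed.

Lemma same_point_sym f s s' : same_point f s s' -> same_point f s' s.
Proof. intros [H1 H2]; split; [auto|]. intros x Hx. rewrite <- H1. apply H2. tauto. Qed.

(** Whatever the order of the three times, an [x] between the outer two lies between [s] and [s'] or
    between [s'] and [s''], and [f] takes one value at all three. *)
Lemma same_point_trans f s s' s'' :
  same_point f s s' -> same_point f s' s'' -> same_point f s s''.
Proof.
intros [H1 H2] [H3 H4]; split; [congruence|]. intros x Hx.
destruct Hx as [Hx|Hx], (Rle_dec s s'), (Rle_dec s' s''), (Rle_dec x s');
  first [lra | apply H2; first [left; lra | right; lra]
        | rewrite H1; apply H4; first [left; lra | right; lra]].
Qed.

(** Step [i] of the contour occupies [[i, i + 1]]. A pair consists of the up step and the down step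
    along the two sides of one edge; [o] is the time at which the contour of the subtree starts. *)
Fixpoint edge_pairs (o : nat) (t : tree) : list (nat * nat) :=
  match t with
  | Leaf => nil
  | Node a b => (o, (o + 1 + size a)%nat)
             :: edge_pairs (o + 1) a ++ edge_pairs (o + 2 + size a) b
  end.

Lemma same_point_child a b s s' : 0 <= s <= rsize a -> 0 <= s' <= rsize a ->
  same_point (contour a) s s' <-> same_point (contour (Node a b)) (1 + s) (1 + s').
Proof.
intros Hs Hs'. unfold same_point.
rewrite !contour_child by lra.
replace (1 + s - 1) with s by ring. replace (1 + s' - 1) with s' by ring.
split; intros [H1 H2]; (split; [lra|]); intros x [Hx|Hx].
1, 2: rewrite contour_child by lra; specialize (H2 (x - 1)); lra.
all: specialize (H2 (1 + x)); rewrite contour_child in H2 by lra;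
  replace (1 + x - 1) with x in H2 by ring; lra.
Qed.

Lemma same_point_next a b s s' : 0 <= s -> 0 <= s' ->
  same_point (contour b) s s' <->
  same_point (contour (Node a b)) (2 + rsize a + s) (2 + rsize a + s').
Proof.
intros Hs Hs'. unfold same_point.
rewrite !contour_next by lra.
replace (2 + rsize a + s - 2 - rsize a) with s by ring.
replace (2 + rsize a + s' - 2 - rsize a) with s' by ring.
split; intros [H1 H2]; (split; [lra|]); intros x [Hx|Hx].
1, 2: rewrite contour_next by lra; specialize (H2 (x - 2 - rsize a)); lra.
all: specialize (H2 (2 + rsize a + x)); rewrite contour_next in H2 by lra;
  replace (2 + rsize a + x - 2 - rsize a) with x in H2 by ring; lra.
Qed.

Lemma edge_pairs_range t o i j : In (i, j) (edge_pairs o t) ->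
  (o <= i /\ i < j /\ j < o + size t)%nat.
Proof.
revert o; induction t as [|a IHa b IHb]; intros o; cbn [edge_pairs size]; [intros []|].
intros [H|H]; [injection H; intros; subst; lia|].
apply in_app_or in H as [H|H]; [apply IHa in H|apply IHb in H]; lia.
Qed.

(** The two sides of an edge are traversed in opposite directions, hence [u] on one side against
    [1 - u] on the other. *)
Lemma edge_pairs_same_point t o i j u :
  In (i, j) (edge_pairs o t) -> 0 <= u <= 1 ->
  same_point (contour t) (INR i - INR o + u) (INR j - INR o + 1 - u).
Proof.
intros Hin Hu; revert o Hin; induction t as [|a IHa b IHb]; intros o; cbn [edge_pairs]; [intros []|].
pose proof (rsize_ge0 a) as Pa; pose proof (rsize_ge0 b) as Pb.
intros [H|H]; [|apply in_app_or in H as [H|H]].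
- injection H; intros; subst. rewrite !plus_INR. simpl (INR 1).
  split.
  + rewrite contour_up, contour_down; lra.
  + intros x Hx. rewrite contour_up by lra.
    destruct (Rle_dec x 1); [rewrite contour_up by lra; lra|].
    destruct (Rle_dec x (1 + rsize a)).
    * rewrite contour_child by lra. pose proof (contour_ge0 a (x - 1)). lra.
    * rewrite contour_down by lra. lra.
- pose proof (edge_pairs_range _ _ _ _ H) as (L1 & L2 & L3).
  apply le_INR in L1, L2, L3. specialize (IHa _ H).
  rewrite ?S_INR, ?plus_INR in *. simpl (INR 1) in *.
  apply (same_point_child a b) in IHa; [|lra..].
  replace (INR i - INR o + u) with (1 + (INR i - (INR o + 1) + u)) by ring.
  replace (INR j - INR o + 1 - u) with (1 + (INR j - (INR o + 1) + 1 - u)) by ring. exact IHa.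
- pose proof (edge_pairs_range _ _ _ _ H) as (L1 & L2 & L3).
  apply le_INR in L1, L2, L3. specialize (IHb _ H).
  rewrite ?S_INR, ?plus_INR in *. simpl (INR 2) in *.
  apply (same_point_next a b) in IHb; [|lra..].
  replace (INR i - INR o + u)
    with (2 + rsize a + (INR i - (INR o + 2 + rsize a) + u)) by ring.
  replace (INR j - INR o + 1 - u)
    with (2 + rsize a + (INR j - (INR o + 2 + rsize a) + 1 - u)) by ring. exact IHb.
Qed.

(** The contour is at least [1] over [a], strictly monotone on the two sides of the first edge, and
    back at [0] at time [2 + rsize a]. So an ordered identified pair is a visit of the root at time
    [0] with a later point, the two sides of the first edge, a pair within [a], or a pair within
    [b]. *)
Lemma same_point_cases a b s s' :
  0 <= s < s' -> s' <= rsize (Node a b) -> same_point (contour (Node a b)) s s' ->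
  (s = 0 /\ 2 + rsize a <= s') \/
  (0 < s < 1 /\ s' = 2 + rsize a - s) \/
  (1 <= s /\ s' <= 1 + rsize a) \/
  (2 + rsize a <= s).
Proof.
rewrite rsize_Node; intros Hs Hs' [H1 H2].
pose proof (rsize_ge0 a) as Pa; pose proof (rsize_ge0 b) as Pb.
destruct (Rle_dec (2 + rsize a) s) as [?|G4]; [tauto|].
destruct (Rlt_dec (1 + rsize a) s) as [G3|G3].
(* The contour falls strictly on this step, so at the earlier of [s'] and the end of the step it is
   already below its value at [s]. *)
{ exfalso. specialize (H2 (Rmin s' (2 + rsize a))).
  revert H2; unfold Rmin; destruct Rle_dec; rewrite !contour_down by lra; lra. }
destruct (Rle_dec 1 s) as [G1|G1].
- right; right; left; split; [lra|]. apply Rnot_lt_le; intros C.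
  specialize (H2 (Rmin s' (2 + rsize a))). rewrite contour_child in H2 by lra.
  pose proof (contour_ge0 a (s - 1)).
  revert H2; unfold Rmin; destruct Rle_dec; rewrite !contour_down by lra; lra.
- rewrite (contour_up a b s) in H1, H2 by lra.
  destruct (Rle_dec s' 1). { rewrite contour_up in H1 by lra. lra. }
  destruct (Rle_dec s' (1 + rsize a)).
  { rewrite contour_child in H1 by lra. pose proof (contour_ge0 a (s' - 1)). lra. }
  destruct (Rle_dec s' (2 + rsize a)).
  { rewrite contour_down in H1 by lra. lra. }
  specialize (H2 (2 + rsize a)). rewrite contour_down in H2 by lra. lra.
Qed.

(** This is what turns the combinatorial gluing into the tree: the identification by height is
    generated by gluing the two sides of each edge. Induction on the tree, with [o] shifting the
    times of the subtrees. *)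
Lemma same_point_generated (P : R -> R -> Prop) t o :
  (forall x, P x x) -> (forall x y z, P x y -> P y z -> P x z) ->
  (forall i j u, In (i, j) (edge_pairs o t) -> 0 <= u <= 1 ->
     P (INR i + u) (INR j + 1 - u)) ->
  forall s s', 0 <= s -> s <= s' -> s' <= rsize t -> same_point (contour t) s s' ->
  P (INR o + s) (INR o + s').
Proof.
intros Pr Pt; revert o; induction t as [|a IHa b IHb]; intros o Pe s s' Hs Hss Hs' H.
- simpl in Hs'. replace s' with s by lra. apply Pr.
- destruct (Req_dec s s') as [->|Hne]; [apply Pr|].
  cbn [edge_pairs] in Pe. pose proof (rsize_ge0 a).
  assert (Ia : forall s s', 0 <= s -> s <= s' -> s' <= rsize a ->
     same_point (contour a) s s' -> P (INR o + 1 + s) (INR o + 1 + s')).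
  { intros. specialize (IHa (o + 1)%nat). rewrite plus_INR in IHa. apply IHa; auto.
    intros; apply Pe; auto. right; apply in_or_app; auto. }
  assert (Ib : forall s s', 0 <= s -> s <= s' -> s' <= rsize b ->
     same_point (contour b) s s' ->
     P (INR o + 2 + rsize a + s) (INR o + 2 + rsize a + s')).
  { intros. specialize (IHb (o + 2 + size a)%nat). rewrite !plus_INR in IHb. apply IHb; auto.
    intros; apply Pe; auto. right; apply in_or_app; auto. }
  assert (Pu : forall u, 0 <= u <= 1 -> P (INR o + u) (INR o + 2 + rsize a - u)).
  { intros u Hu. specialize (Pe o (o + 1 + size a)%nat u). rewrite !plus_INR in Pe.
    simpl (INR 1) in Pe.
    replace (INR o + 2 + rsize a - u) with (INR o + 1 + rsize a + 1 - u) by ring.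
    apply Pe; auto. left; reflexivity. }
  rewrite rsize_Node in Hs'.
  destruct (same_point_cases a b s s') as [[-> C]|[[C ->]|[C|C]]]; auto; try lra.
  + rewrite rsize_Node; lra.
  (* Two visits of the root are linked child by child: the feet of the first edge are glued by its
     own pair at [u = 0], and the later siblings are covered by induction. *)
  + apply Pt with (INR o + 2 + rsize a - 0); [apply Pu; lra|].
    replace (INR o + 2 + rsize a - 0) with (INR o + 2 + rsize a + 0) by ring.
    replace (INR o + s') with (INR o + 2 + rsize a + (s' - 2 - rsize a)) by ring.
    apply Ib; try lra. apply (same_point_next a b); try lra.
    replace (2 + rsize a + (s' - 2 - rsize a)) with s' by ring.
    split; rewrite contour_next by lra; replace (2 + rsize a + 0 - 2 - rsize a) with 0 by ring;
      rewrite (contour_out b 0) by lra.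
    * destruct H as [H _]. rewrite contour_up in H by lra. exact H.
    * intros; apply contour_ge0.
  + replace (INR o + (2 + rsize a - s)) with (INR o + 2 + rsize a - s) by ring.
    apply Pu; lra.
  + replace (INR o + s) with (INR o + 1 + (s - 1)) by ring.
    replace (INR o + s') with (INR o + 1 + (s' - 1)) by ring.
    apply Ia; try lra. apply (same_point_child a b); try lra.
    replace (1 + (s - 1)) with s by ring. now replace (1 + (s' - 1)) with s' by ring.
  + replace (INR o + s) with (INR o + 2 + rsize a + (s - 2 - rsize a)) by ring.
    replace (INR o + s') with (INR o + 2 + rsize a + (s' - 2 - rsize a)) by ring.
    apply Ib; try lra. apply (same_point_next a b); try lra.
    replace (2 + rsize a + (s - 2 - rsize a)) with s by ring.
    now replace (2 + rsize a + (s' - 2 - rsize a)) with s' by ring.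
Qed.

Definition endpoints (l : list (nat * nat)) : list nat :=
  flat_map (fun p => fst p :: snd p :: nil) l.

(** Every contour step is a side of exactly one edge. The glued arcs are therefore disjoint, and
    their lengths add up to the whole boundary. *)
Lemma endpoints_perm t o : Permutation (endpoints (edge_pairs o t)) (seq o (size t)).
Proof.
revert o; induction t as [|a IHa b IHb]; intros o; cbn [edge_pairs size]; [reflexivity|].
unfold endpoints in *; cbn [flat_map fst snd app]. rewrite flat_map_app.
replace (2 + size a + size b)%nat with (S (size a + S (size b))) by lia.
cbn [seq]. constructor. rewrite seq_app. cbn [seq].
rewrite <- Permutation_middle. replace (S o + size a)%nat with (o + 1 + size a)%nat by lia.
constructor. rewrite IHa, IHb. replace (o + 1)%nat with (S o) by lia.
now replace (S (S o + size a))%nat with (o + 2 + size a)%nat by lia.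
Qed.

(** * Weights collected at the points of the tree *)

Fixpoint visits (o : nat) (t : tree) : list nat :=
  o :: match t with Leaf => nil | Node a b => visits (o + 2 + size a) b end.

Definition total (w : nat -> R) (l : list nat) : R := fold_right Rplus 0 (map w l).

(** [visits (o + 1) a] lists the corners at the upper end of the first edge, so every vertex except
    the root is bounded. The root is treated apart because its first and last corner are the same
    point of the polygon. *)
Fixpoint inner_ok (B : R) (w : nat -> R) (o : nat) (t : tree) : Prop :=
  match t with
  | Leaf => True
  | Node a b => total w (visits (o + 1) a) <= B /\ inner_ok B w (o + 1) a
             /\ inner_ok B w (o + 2 + size a) b
  end.

Lemma not_INR_between (o j : nat) (u : R) : 0 < u < 1 -> INR o + u <> INR j.
Proof.
intros H C. assert (o < j)%nat by (apply INR_lt; lra).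
assert (j < S o)%nat by (apply INR_lt; rewrite S_INR; lra). lia.
Qed.

Lemma contour_zero_visits t o s : 0 <= s <= rsize t -> contour t s = 0 ->
  exists j, In j (visits o t) /\ INR o + s = INR j.
Proof.
revert o s; induction t as [|a IHa b IHb]; intros o s Hs H.
- exists o; split; [left; reflexivity|]. simpl in Hs; lra.
- rewrite rsize_Node in Hs. pose proof (rsize_ge0 a).
  destruct (Rle_dec s 1).
  { rewrite contour_up in H by lra. exists o; split; [left; reflexivity|lra]. }
  destruct (Rle_dec s (1 + rsize a)).
  { rewrite contour_child in H by lra. pose proof (contour_ge0 a (s - 1)). lra. }
  assert (2 + rsize a <= s).
  { apply Rnot_lt_le; intros C. rewrite contour_down in H by lra. lra. }
  rewrite contour_next in H by lra.
  destruct (IHb (o + 2 + size a)%nat (s - 2 - rsize a)) as (j & Hj & Ej); try lra.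
  exists j; split; [right; exact Hj|]. rewrite !plus_INR in Ej. simpl (INR 2) in Ej. lra.
Qed.

Definition rtotal (w : R -> R) (l : list R) : R := fold_right Rplus 0 (map w l).

Lemma same_point_child_inv a b s s' : 1 <= s <= 1 + rsize a -> 0 <= s' <= rsize (Node a b) ->
  same_point (contour (Node a b)) s s' ->
  1 <= s' <= 1 + rsize a /\ same_point (contour a) (s - 1) (s' - 1).
Proof.
intros Hs Hs' H. rewrite rsize_Node in Hs'. pose proof (rsize_ge0 b).
assert (R : 1 <= s' <= 1 + rsize a).
{ destruct H as [H1 H2]. rewrite (contour_child a b s) in H1, H2 by lra.
  pose proof (contour_ge0 a (s - 1)).
  split; apply Rnot_lt_le; intros C.
  - rewrite contour_up in H1 by lra. lra.
  - specialize (H2 (Rmin s' (2 + rsize a))). revert H2; unfold Rmin; destruct Rle_dec;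
      rewrite !contour_down by lra; lra. }
split; [exact R|]. apply (same_point_child a b); try lra.
replace (1 + (s - 1)) with s by ring. now replace (1 + (s' - 1)) with s' by ring.
Qed.

(** Positive height excludes the root, which is the only point of [b] that the contour also meets
    before [2 + rsize a]: an earlier [s'] would have the return to height [0] between it and [s]. *)
Lemma same_point_next_inv a b s s' : 2 + rsize a <= s -> 0 < contour (Node a b) s ->
  0 <= s' <= rsize (Node a b) -> same_point (contour (Node a b)) s s' ->
  2 + rsize a <= s' /\ same_point (contour b) (s - 2 - rsize a) (s' - 2 - rsize a).
Proof.
intros Hs Hp Hs' H. pose proof (rsize_ge0 a).
assert (R : 2 + rsize a <= s').
{ apply Rnot_lt_le; intros C. destruct H as [_ H]. specialize (H (2 + rsize a)).
  rewrite (contour_down a b (2 + rsize a)) in H by lra. lra. }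
split; [exact R|]. apply (same_point_next a b); try lra.
replace (2 + rsize a + (s - 2 - rsize a)) with s by ring.
now replace (2 + rsize a + (s' - 2 - rsize a)) with s' by ring.
Qed.

(** A point inside an edge has two times, neither an integer, of weight at most [B / 2] each. A
    vertex other than the root has the integer times of its visits, which [inner_ok] bounds. Only a
    list covering the class is produced, which suffices for an upper bound on angles. *)
Lemma same_point_class (B : R) (w : R -> R) t o s :
  (forall x, (forall j, x <> INR j) -> w x <= B / 2) ->
  inner_ok B (fun i => w (INR i)) o t ->
  0 <= s <= rsize t -> 0 < contour t s ->
  exists l, (forall s', 0 <= s' <= rsize t -> same_point (contour t) s s' ->
               In (INR o + s') l)
            /\ rtotal w l <= B.
Proof.
intros Hw. revert o s; induction t as [|a IHa b IHb]; intros o s Hok Hs Hp.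
{ simpl in Hp; lra. }
cbn [inner_ok] in Hok. destruct Hok as (O1 & O2 & O3).
pose proof (rsize_ge0 a) as Pa; pose proof (rsize_ge0 b) as Pb.
rewrite rsize_Node in Hs.
assert (Edge : forall u, 0 < u < 1 -> (s = u \/ s = 2 + rsize a - u) ->
  exists l, (forall s', 0 <= s' <= rsize (Node a b) -> same_point (contour (Node a b)) s s' ->
               In (INR o + s') l) /\ rtotal w l <= B).
{ intros u Hu Es. exists ((INR o + u) :: (INR o + (2 + rsize a - u)) :: nil); split.
  - intros s' Hs' H.
    assert (s' = u \/ s' = 2 + rsize a - u) as [->| ->]; [|left; reflexivity|right; left; reflexivity].
    destruct (Rtotal_order s s') as [L|[<-|L]]; [|tauto|].
    + destruct (same_point_cases a b s s') as [C|[C|[C|C]]]; auto; destruct Es; try lra.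
    + apply same_point_sym in H.
      destruct (same_point_cases a b s' s) as [C|[C|[C|C]]]; auto; rewrite ?rsize_Node in *; destruct Es; try lra.
  - unfold rtotal; cbn [map fold_right].
    assert (w (INR o + u) <= B / 2) by (apply Hw; intros j; apply not_INR_between; lra).
    assert (w (INR o + (2 + rsize a - u)) <= B / 2); [|lra].
    apply Hw; intros j C. apply (not_INR_between (o + 1 + size a) j (1 - u)); [lra|].
    rewrite !plus_INR. simpl (INR 1). lra. }
destruct (Rlt_dec s 1) as [L1|L1].
{ apply (Edge s); [|tauto]. rewrite contour_up in Hp; lra. }
destruct (Rle_dec s (1 + rsize a)) as [L2|L2].
- destruct (Req_dec (contour a (s - 1)) 0) as [Z|Z].
  + exists (map INR (visits (o + 1) a)); split.
    * intros s' Hs' HH. apply same_point_child_inv in HH as [R H1]; [|rewrite ?rsize_Node in *; lra..].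
      destruct H1 as [H1 _]. rewrite Z in H1.
      destruct (contour_zero_visits a (o + 1) (s' - 1)) as (j & Hj & Ej); [lra|auto|].
      rewrite plus_INR in Ej. simpl (INR 1) in Ej. replace (INR o + s') with (INR j) by lra.
      now apply in_map.
    * unfold rtotal, total in *. rewrite map_map. exact O1.
  + pose proof (contour_ge0 a (s - 1)) as Pc.
    destruct (IHa (o + 1)%nat (s - 1)) as (l & Hl & Sl); auto; try lra.
    exists l; split; [|exact Sl]. intros s' Hs' HH.
    apply same_point_child_inv in HH as [R H1]; [|rewrite ?rsize_Node in *; lra..].
    replace (INR o + s') with (INR (o + 1) + (s' - 1)) by (rewrite plus_INR; simpl (INR 1); ring).
    apply Hl; auto; lra.
- destruct (Rlt_dec s (2 + rsize a)) as [L3|L3].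
  { apply (Edge (2 + rsize a - s)); [lra|]. right; ring. }
  destruct (IHb (o + 2 + size a)%nat (s - 2 - rsize a)) as (l & Hl & Sl); auto; try lra.
  { now rewrite contour_next in Hp by lra. }
  exists l; split; [|exact Sl]. intros s' Hs' HH.
  apply same_point_next_inv in HH as [R H1]; auto; try lra.
  replace (INR o + s') with (INR (o + 2 + size a) + (s' - 2 - rsize a))
    by (rewrite !plus_INR; simpl (INR 2); ring).
  rewrite rsize_Node in Hs'. apply Hl; auto; lra.
Qed.

(** * Caterpillars *)

Fixpoint stem (r : nat) (t : tree) : tree :=
  match r with O => t | S r' => Node (stem r' t) Leaf end.

(** The contour of [caterpillar r (b :: bs)] reads [UUDD UUUU w DDDD] when [b] is true and
    [UUUU UUDD w DDDD] otherwise, where [w] is the contour of [caterpillar r bs]. *)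
Fixpoint caterpillar (r : nat) (bs : list bool) : tree :=
  match bs with
  | nil => stem r Leaf
  | true :: bs' => Node (Node Leaf Leaf) (stem 4 (caterpillar r bs'))
  | false :: bs' => stem 4 (Node (Node Leaf Leaf) (caterpillar r bs'))
  end.

Lemma size_stem r t : size (stem r t) = (2 * r + size t)%nat.
Proof. induction r as [|r IH]; cbn [stem size]; lia. Qed.

Lemma size_caterpillar r bs : size (caterpillar r bs) = (2 * r + 12 * length bs)%nat.
Proof.
induction bs as [|[] bs IH]; cbn [caterpillar length]; rewrite ?size_stem; cbn [size];
  rewrite ?size_stem; cbn [size]; lia.
Qed.

(** A vertex inside the stem has a single child, so it is visited just twice, on the way up at
    [o + i] and on the way down at the mirror time. The visits of [t] take place at the top of the
    stem. *)
Lemma inner_ok_stem B w o r t :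
  (forall i, (0 < i < r)%nat -> w (o + i)%nat + w (o + 2 * r + size t - i)%nat <= B) ->
  total w (visits (o + r) t) <= B -> inner_ok B w (o + r) t -> inner_ok B w o (stem r t).
Proof.
revert o; induction r as [|r IH]; intros o Hp Ht Hi.
- now rewrite Nat.add_0_r in Hi.
- cbn [stem inner_ok]. split; [|split; [|exact I]].
  + destruct r as [|r]; [exact Ht|].
    cbn [stem visits]. unfold total; cbn [map fold_right].
    specialize (Hp 1%nat). rewrite size_stem.
    replace (o + 1 + 2 + (2 * r + size t))%nat with (o + 2 * S (S r) + size t - 1)%nat by lia.
    specialize (Hp ltac:(lia)). lra.
  + apply IH; replace (o + 1 + r)%nat with (o + S r)%nat by lia; auto.
    intros i Hi'. specialize (Hp (S i)).
    replace (o + 1 + i)%nat with (o + S i)%nat by lia.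
    replace (o + 1 + 2 * r + size t - i)%nat with (o + 2 * S r + size t - S i)%nat by lia.
    apply Hp; lia.
Qed.

Ltac mp_lra :=
  repeat match goal with H : ?P -> _, H' : ?P |- _ => specialize (H H') end; lra.

(** * Weights in a caterpillar: [a] for tips, [b] for reflex vertices, half of [B] for edge
    midpoints *)

Section Angles.
Variables (a b B : R) (w : nat -> R).
Hypothesis a_ge0 : 0 <= a.
Hypothesis b_ge0 : 0 <= b.
Hypothesis abB : 3 * a + b <= B.
Hypothesis w_odd : forall j, Nat.odd j = true -> w j <= B / 2.
Hypothesis w_0 : forall j, (j mod 4 = 0)%nat -> w j <= b.
Hypothesis w_2 : forall j, (j mod 4 = 2)%nat -> w j <= a.

(** Times with sum [2] modulo [4] are two odd times, hence two edge midpoints, or a tip against a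
    reflex vertex. Two reflex vertices, which could be too heavy together, never face each other. *)
Lemma w_opposite i j : ((i + j) mod 4 = 2)%nat -> w i + w j <= B.
Proof.
intros H. destruct (Nat.odd i) eqn:Oi.
- assert (Oj : Nat.odd j = true).
  { apply Nat.odd_spec in Oi as [x ->]. apply Nat.odd_spec.
    pose proof (Nat.div_mod_eq (2 * x + 1 + j) 4). exists (2 * ((2 * x + 1 + j) / 4) - x)%nat. lia. }
  pose proof (w_odd _ Oi); pose proof (w_odd _ Oj). lra.
- assert (Ei : Nat.even i = true) by (rewrite <- Nat.negb_odd, Oi; reflexivity).
  apply Nat.even_spec in Ei as [x ->].
  pose proof (Nat.div_mod_eq (2 * x + j) 4). pose proof (Nat.div_mod_eq (2 * x) 4).
  pose proof (Nat.mod_upper_bound (2 * x) 4).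
  assert (2 * x mod 4 = 0 \/ 2 * x mod 4 = 2)%nat as [M|M] by lia.
  + assert (j mod 4 = 2)%nat.
    { symmetry; apply (Nat.mod_unique j 4 ((2 * x + j) / 4 - 2 * x / 4)); lia. }
    pose proof (w_0 _ M). pose proof (w_2 j). mp_lra.
  + assert (j mod 4 = 0)%nat.
    { symmetry; apply (Nat.mod_unique j 4 ((2 * x + j) / 4 - 2 * x / 4)); lia. }
    pose proof (w_2 _ M). pose proof (w_0 j). mp_lra.
Qed.

Lemma mod4 x q r : (r < 4)%nat -> x = (4 * q + r)%nat -> (x mod 4 = r)%nat.
Proof. intros Hr ->. symmetry; now apply (Nat.mod_unique _ 4 q). Qed.

(** Zipping from a tip at [o] joins the midpoints at [o + 1] and [o + 3] and leaves the reflex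
    vertex at [o + 2] alone at the end of the zip. *)
Lemma inner_ok_zip o : (o mod 4 = 2)%nat -> inner_ok B w o (Node Leaf Leaf) /\
  total w (visits (o + 1) (Node Leaf Leaf)) <= B /\
  inner_ok B w (o + 1) (Node Leaf Leaf).
Proof.
intros Ho. pose proof (Nat.div_mod_eq o 4).
assert (Nat.odd (o + 1) = true) by (apply Nat.odd_spec; exists (2 * (o / 4) + 1)%nat; lia).
assert (Nat.odd (o + 1 + 2 + 0) = true) by (apply Nat.odd_spec; exists (2 * (o / 4) + 2)%nat; lia).
assert ((o + 1 + 1) mod 4 = 0)%nat by (apply (mod4 _ (o / 4 + 1)); lia).
pose proof (w_odd (o + 1)); pose proof (w_odd (o + 1 + 2 + 0)); pose proof (w_0 (o + 1 + 1)).
cbn [inner_ok visits size]; unfold total; cbn [map fold_right].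
repeat split; mp_lra.
Qed.

(** The second part is the induction invariant: besides its first corner, a tip, the root of a
    caterpillar carries weight at most [a + b], which leaves room for the tips contributed by the
    block below. A block advances by eight steps, so each one starts at a tip again, and [r] odd
    puts the innermost fold point on an edge midpoint. *)
Lemma caterpillar_ok r bs o : Nat.odd r = true -> (o mod 4 = 2)%nat ->
  inner_ok B w o (caterpillar r bs) /\
  exists l, visits o (caterpillar r bs) = o :: l /\ total w l <= a + b.
Proof.
intros Hr. pose proof Hr as Hr'. apply Nat.odd_spec in Hr' as [x Hx].
revert o; induction bs as [|c bs IH]; intros o Ho; pose proof (Nat.div_mod_eq o 4) as Eo.
- cbn [caterpillar]. split.
  + apply inner_ok_stem; [|cbn [visits]; unfold total; cbn [map fold_right]|exact I].
    * intros i Hi. apply w_opposite. cbn [size]. apply (mod4 _ (2 * (o / 4) + x + 1)); lia.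
    * pose proof (w_odd (o + r)).
      assert (Nat.odd (o + r) = true)
        by (apply Nat.odd_spec; exists (2 * (o / 4) + 1 + x)%nat; lia).
      mp_lra.
  + destruct r as [|r]; [discriminate|].
    exists ((o + 2 + size (stem r Leaf))%nat :: nil); split; [reflexivity|].
    unfold total; cbn [map fold_right]. rewrite size_stem; cbn [size].
    pose proof (w_0 (o + 2 + (2 * r + 0))).
    assert ((o + 2 + (2 * r + 0)) mod 4 = 0)%nat by (apply (mod4 _ (o / 4 + x + 1)); lia).
    mp_lra.
- destruct (inner_ok_zip o Ho) as (Z1 & Z2 & Z3).
  assert (Ho4 : ((o + 4) mod 4 = 2)%nat) by (apply (mod4 _ (o / 4 + 1)); lia).
  assert (Ho8 : ((o + 4 + 4) mod 4 = 2)%nat) by (apply (mod4 _ (o / 4 + 2)); lia).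
  destruct (IH (o + 4 + 4)%nat Ho8) as (I1 & l & El & Il).
  destruct (inner_ok_zip (o + 4) Ho4) as (Y1 & Y2 & Y3).
  pose proof (w_2 _ Ho); pose proof (w_2 _ Ho4) as W4; pose proof (w_2 _ Ho8) as W8.
  destruct c; cbn [caterpillar]; split.
  + change (total w (visits (o + 1) (Node Leaf Leaf)) <= B /\
      inner_ok B w (o + 1) (Node Leaf Leaf) /\
      inner_ok B w (o + 2 + size (Node Leaf Leaf)) (stem 4 (caterpillar r bs))).
    replace (o + 2 + size (Node Leaf Leaf))%nat with (o + 4)%nat
      by (cbn [size]; lia).
    split; [exact Z2|split; [exact Z3|]].
    * apply inner_ok_stem; [| |exact I1].
      -- intros i Hi. apply w_opposite. rewrite size_caterpillar.
         apply (mod4 _ (2 * (o / 4) + x + 3 * length bs + 5)); lia.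
      -- rewrite El. unfold total in *; cbn [map fold_right]. lra.
  + eexists; split; [reflexivity|].
    cbn [visits stem size]. unfold total; cbn [map fold_right].
    rewrite size_caterpillar.
    match goal with |- w ?p + (w ?q + 0) <= _ =>
      pose proof (w_2 p); pose proof (w_0 q);
      assert (p mod 4 = 2)%nat by (apply (mod4 _ (o / 4 + 1)); lia);
      assert (q mod 4 = 0)%nat by (apply (mod4 _ (o / 4 + x + 3 * length bs + 4)); lia) end.
    mp_lra.
  + apply inner_ok_stem.
    * intros i Hi. apply w_opposite. cbn [size]. rewrite size_caterpillar.
      apply (mod4 _ (2 * (o / 4) + x + 3 * length bs + 4)); lia.
    (* The extremal vertex: the tips at [o + 4] and [o + 8] join the remaining corners of weight
       [a + b] of the next caterpillar, besides whose first tip [o + 8] they already count, giving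
       [3 * a + b]. *)
    * cbn [visits]. replace (o + 4 + 2 + size (Node Leaf Leaf))%nat with (o + 4 + 4)%nat
        by (cbn [size]; lia).
      rewrite El. unfold total in *; cbn [map fold_right]. lra.
    * change (total w (visits (o + 4 + 1) (Node Leaf Leaf)) <= B /\
        inner_ok B w (o + 4 + 1) (Node Leaf Leaf) /\
        inner_ok B w (o + 4 + 2 + size (Node Leaf Leaf)) (caterpillar r bs)).
      replace (o + 4 + 2 + size (Node Leaf Leaf))%nat with (o + 4 + 4)%nat
        by (cbn [size]; lia).
      tauto.
  + eexists; split; [reflexivity|].
    cbn [visits stem size]. unfold total; cbn [map fold_right].
    rewrite size_caterpillar.
    match goal with |- w ?q + 0 <= _ =>
      pose proof (w_0 q);
      assert (q mod 4 = 0)%nat by (apply (mod4 _ (o / 4 + x + 3 * length bs + 4)); lia) end.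
    mp_lra.
Qed.
End Angles.

Lemma same_point_stem r t s s' : 0 <= s <= rsize t -> 0 <= s' <= rsize t ->
  same_point (contour t) s s' ->
  same_point (contour (stem r t)) (INR r + s) (INR r + s').
Proof.
intros Hs Hs' H; induction r as [|r IH].
- cbn [stem]. simpl (INR 0). now rewrite !Rplus_0_l.
- apply (same_point_child (stem r t) Leaf) in IH.
  + rewrite S_INR. replace (INR r + 1 + s) with (1 + (INR r + s)) by ring.
    now replace (INR r + 1 + s') with (1 + (INR r + s')) by ring.
  + rewrite size_stem, plus_INR, mult_INR. simpl (INR 2). pose proof (pos_INR r). lra.
  + rewrite size_stem, plus_INR, mult_INR. simpl (INR 2). pose proof (pos_INR r). lra.
Qed.

Lemma contour_stem r t s : 0 <= s <= rsize t ->
  contour (stem r t) (INR r + s) = INR r + contour t s.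
Proof.
intros Hs; induction r as [|r IH].
- cbn [stem]. simpl (INR 0). now rewrite !Rplus_0_l.
- cbn [stem]. rewrite S_INR, contour_child.
  + replace (INR r + 1 + s - 1) with (INR r + s) by ring. rewrite IH. ring.
  + rewrite size_stem, plus_INR, mult_INR. simpl (INR 2). pose proof (pos_INR r). lra.
Qed.

(** Both kinds of block take eight contour steps before the remaining caterpillar begins, so the
    position of a block does not depend on the earlier choices. *)
Lemma same_point_cons r c bs s s' :
  0 <= s <= rsize (caterpillar r bs) -> 0 <= s' <= rsize (caterpillar r bs) ->
  same_point (contour (caterpillar r bs)) s s' ->
  same_point (contour (caterpillar r (c :: bs))) (8 + s) (8 + s').
Proof.
intros Hs Hs' H.
assert (Z : rsize (Node Leaf Leaf) = 2) by (simpl; ring).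
destruct c; cbn [caterpillar].
- replace (8 + s) with (2 + rsize (Node Leaf Leaf) + (INR 4 + s)) by (simpl; ring).
  replace (8 + s') with (2 + rsize (Node Leaf Leaf) + (INR 4 + s')) by (simpl; ring).
  apply same_point_next; try (simpl; lra). now apply same_point_stem.
- replace (8 + s) with (INR 4 + (2 + rsize (Node Leaf Leaf) + s)) by (simpl; ring).
  replace (8 + s') with (INR 4 + (2 + rsize (Node Leaf Leaf) + s')) by (simpl; ring).
  apply same_point_stem; try (rewrite (rsize_Node _ (caterpillar r bs)); lra).
  apply same_point_next; try lra; auto.
Qed.

Lemma contour_cons r c bs s : 0 <= s <= rsize (caterpillar r bs) ->
  contour (caterpillar r (c :: bs)) (8 + s) = 4 + contour (caterpillar r bs) s.
Proof.
intros Hs.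
assert (Z : rsize (Node Leaf Leaf) = 2) by (simpl; ring).
assert (F : INR 4 = 4) by (simpl; ring).
destruct c; cbn [caterpillar].
- rewrite contour_next by lra.
  replace (8 + s - 2 - rsize (Node Leaf Leaf)) with (INR 4 + s) by lra.
  rewrite contour_stem by lra. lra.
- replace (8 + s) with (INR 4 + (4 + s)) by lra.
  rewrite contour_stem by (rewrite (rsize_Node _ (caterpillar r bs)); lra).
  rewrite contour_next by lra.
  replace (4 + s - 2 - rsize (Node Leaf Leaf)) with s by lra. lra.
Qed.

(** Block [i] starts at time [8 i]; this time and [8 i + 4] will be two consecutive tips. A zip of
    the first two edges joins them, while otherwise the contour rises by [4] in between, so that not
    even the heights agree. *)
Lemma caterpillar_block r bs i : (i < length bs)%nat ->
  8 * INR i + 4 <= rsize (caterpillar r bs) /\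
  (nth i bs false = true ->
     same_point (contour (caterpillar r bs)) (8 * INR i) (8 * INR i + 4)) /\
  (nth i bs false = false ->
     contour (caterpillar r bs) (8 * INR i) <> contour (caterpillar r bs) (8 * INR i + 4)).
Proof.
intros Hi. split.
{ rewrite size_caterpillar, plus_INR, !mult_INR.
  assert (INR i + 1 <= INR (length bs)) by (rewrite <- S_INR; now apply le_INR).
  pose proof (pos_INR r); pose proof (pos_INR i).
  replace (INR 12) with 12 by (simpl; ring). replace (INR 2) with 2 by (simpl; ring). lra. }
assert (Z : rsize (Node Leaf Leaf) = 2) by (simpl; ring).
assert (F : INR 4 = 4) by (simpl; ring).
revert i Hi; induction bs as [|c bs IH]; intros i Hi; [simpl in Hi; lia|].
destruct i as [|i].
- simpl (INR 0). rewrite !Rmult_0_r, Rplus_0_l. cbn [nth]. split; intros ->; cbn [caterpillar].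
  + replace 0 with (INR 0 - INR 0 + 0) at 1 by (simpl; ring).
    pose proof (rsize_ge0 (stem 4 (caterpillar r bs))).
    split.
    * replace (INR 0 - INR 0 + 0) with 0 by (simpl; ring).
      rewrite contour_up, contour_next by lra. rewrite contour_out; [reflexivity|lra].
    * intros. replace (INR 0 - INR 0 + 0) with 0 by (simpl; ring).
      rewrite contour_up by lra. apply contour_ge0.
  + rewrite (contour_out _ 0) by lra.
    replace 4 with (INR 4 + 0) by lra.
    rewrite contour_stem by (split; [lra|apply rsize_ge0]). rewrite contour_out by lra. lra.
- cbn [nth]. cbn [length] in Hi. assert (Hi' : (i < length bs)%nat) by lia.
  destruct (IH i Hi') as [I1 I2].
  rewrite S_INR. replace (8 * (INR i + 1)) with (8 + 8 * INR i) by ring.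
  replace (8 + 8 * INR i + 4) with (8 + (8 * INR i + 4)) by ring.
  assert (L : 0 <= 8 * INR i /\ 8 * INR i + 4 <= rsize (caterpillar r bs)).
  { rewrite size_caterpillar, plus_INR, !mult_INR.
    assert (INR i + 1 <= INR (length bs)) by (rewrite <- S_INR; now apply le_INR).
    pose proof (pos_INR r); pose proof (pos_INR i).
    replace (INR 12) with 12 by (simpl; ring). replace (INR 2) with 2 by (simpl; ring). lra. }
  split; intros Hb.
  + apply same_point_cons; auto; lra.
  + rewrite !contour_cons by lra. specialize (I2 Hb). lra.
Qed.

(** * The sphere of a contour *)

Lemma cos_sin_inj x y : Rabs (x - y) < 2 * PI -> cos x = cos y -> sin x = sin y -> x = y.
Proof.
intros H Hc Hs.
assert (C : cos (x - y) = 1).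
{ rewrite cos_minus, Hc, Hs. pose proof (sin2_cos2 y). unfold Rsqr in *. lra. }
replace (x - y) with (2 * ((x - y) / 2)) in C by field.
rewrite cos_2a_sin in C.
assert (S : sin ((x - y) / 2) = 0) by nra.
apply Rabs_def2 in H. pose proof PI_RGT_0.
destruct (Rtotal_order ((x - y) / 2) 0) as [L|[L|L]]; [|lra|].
- assert (0 < sin (- ((x - y) / 2))) by (apply sin_gt_0; lra).
  rewrite sin_neg in *. lra.
- assert (0 < sin ((x - y) / 2)) by (apply sin_gt_0; lra). lra.
Qed.

Lemma polar_unit x y : x ^ 2 + y ^ 2 = 1 ->
  exists th, 0 <= th < 2 * PI /\ cos th = x /\ sin th = y.
Proof.
intros H. assert (Hx : -1 <= x <= 1) by nra.
pose proof (acos_bound x) as Hb. pose proof PI_RGT_0.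
assert (S : sqrt (1 - x²) = Rabs y).
{ replace (1 - x²) with (y²) by (unfold Rsqr; lra). apply sqrt_Rsqr_abs. }
destruct (Rle_dec 0 y) as [P|P].
- exists (acos x). rewrite cos_acos, sin_acos, S by lra. rewrite Rabs_pos_eq by lra. lra.
- exists (2 * PI - acos x). repeat split.
  + lra.
  + destruct (Req_dec (acos x) 0) as [Z|Z]; [|lra].
    assert (cos (acos x) = 1) by (rewrite Z; apply cos_0).
    rewrite cos_acos in * by lra. exfalso; subst x. nra.
  + rewrite cos_minus, cos_2PI, sin_2PI, cos_acos by lra. ring.
  + rewrite sin_minus, cos_2PI, sin_2PI, sin_acos, S by lra. rewrite Rabs_left by lra. ring.
Qed.

Section SphereMap.
Variables (tau : R -> R) (M T : R).
Hypothesis tau_cont : forall s, continuous tau s.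
Hypothesis tau_ge0 : forall s, 0 <= tau s.
Hypothesis tau_lt : forall s, tau s < M.
Hypothesis T_gt0 : 0 < T.
Hypothesis tau_0 : tau 0 = 0.
Hypothesis tau_T : tau T = 0.

Let M_gt0 : 0 < M.
Proof. rewrite <- tau_0. apply tau_lt. Qed.

(** [below s Y] increases with [s] exactly where [tau] is below the level [Y]. *)
Definition clearance (Y t : R) : R := Rmax 0 (Y - tau t).
Definition below (s Y : R) : R := RInt (clearance Y) 0 s.

Lemma clearance_continuous Y t : continuous (clearance Y) t.
Proof.
apply (continuous_ext (fun t => (Y - tau t + Rabs (Y - tau t)) / 2)).
{ intros x. unfold clearance, Rmax, Rabs. destruct Rle_dec, Rcase_abs; lra. }
assert (C : continuous (fun t => Y - tau t) t).
{ apply (continuous_minus (V:=R_NormedModule)); [apply continuous_const|apply tau_cont]. }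
apply (continuous_mult (K:=R_AbsRing)); [|apply continuous_const].
apply (continuous_plus (V:=R_NormedModule)); [exact C|].
apply (continuous_comp _ Rabs); [exact C|apply continuous_Rabs].
Qed.

Lemma clearance_RInt Y a b : ex_RInt (clearance Y) a b.
Proof. apply (ex_RInt_continuous (V:=R_CompleteNormedModule)). intros; apply clearance_continuous. Qed.

Lemma clearance_ge0 Y t : 0 <= clearance Y t.
Proof. apply Rmax_l. Qed.

Lemma below_Chasles Y a b : below b Y = below a Y + RInt (clearance Y) a b.
Proof. symmetry. apply (RInt_Chasles (V:=R_CompleteNormedModule)); apply clearance_RInt. Qed.

Lemma below_0 Y : below 0 Y = 0.
Proof. apply (RInt_point (V:=R_CompleteNormedModule)). Qed.

Lemma below_mono Y a b : a <= b -> below a Y <= below b Y.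
Proof.
intros H. rewrite (below_Chasles Y a b).
assert (0 <= RInt (clearance Y) a b); [|lra].
apply RInt_ge_0; auto using clearance_RInt, clearance_ge0.
Qed.

Lemma below_const Y a b : a <= b -> (forall t, a <= t <= b -> Y <= tau t) ->
  below a Y = below b Y.
Proof.
intros H Ht. rewrite (below_Chasles Y a b).
assert (Rabs (RInt (clearance Y) a b) <= (b - a) * 0) as Hb.
{ apply abs_RInt_le_const; auto using clearance_RInt.
  intros t Hab. specialize (Ht t Hab). unfold clearance. rewrite Rmax_left by lra.
  rewrite Rabs_R0. lra. }
rewrite Rmult_0_r in Hb. apply Rabs_le_between in Hb. lra.
Qed.

(** The clearance is continuous and nonnegative, so a single time with [tau t < Y] yields a short
    interval inside [[a, b]] with positive integral. Times at the ends of [[a, b]] are included,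
    which is used at the seam. *)
Lemma below_eq_inv Y a b : below a Y = below b Y -> forall t, a <= t <= b -> a < b -> Y <= tau t.
Proof.
intros H t Ht Hab. apply Rnot_lt_le; intros C.
assert (P : locally t (fun x => tau x < Y)).
{ apply (tau_cont t (fun y => y < Y)). apply (open_lt Y); exact C. }
destruct P as [d Hd]. pose proof (cond_pos d).
set (p := Rmax a (t - d / 2)). set (q := Rmin b (t + d / 2)).
assert (a <= p /\ t - d / 2 <= p /\ q <= b /\ q <= t + d / 2 /\ p < q).
{ unfold p, q, Rmax, Rmin. destruct Rle_dec, Rle_dec; lra. }
assert (0 < RInt (clearance Y) p q).
{ apply RInt_gt_0; [lra| |intros; apply clearance_continuous].
  intros x Hx. unfold clearance. assert (tau x < Y); [|rewrite Rmax_right; lra].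
  apply Hd. apply Rabs_def1; unfold minus, plus, opp; simpl; lra. }
pose proof (below_Chasles Y p q). pose proof (below_mono Y a p). pose proof (below_mono Y q b). lra.
Qed.

(** Moving [s] costs at most the bound [Rabs Y0 + 1] on the clearance, which uses [tau >= 0]; moving
    [Y] costs at most the length of the interval, since the clearance is 1-Lipschitz in [Y]. *)
Lemma below_lipschitz s Y s0 Y0 : Rabs (Y - Y0) <= 1 ->
  Rabs (below s Y - below s0 Y0) <= Rabs (s - s0) * (Rabs Y0 + 1) + Rabs s0 * Rabs (Y - Y0).
Proof.
intros HY.
assert (B : forall a b f K, (forall t, Rabs (f t) <= K) -> ex_RInt f a b ->
  Rabs (RInt f a b) <= Rabs (b - a) * K).
{ intros a b f K Hf Hi. destruct (Rle_dec a b).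
  - rewrite (Rabs_pos_eq (b - a)) by lra. apply abs_RInt_le_const; auto.
  - rewrite <- (opp_RInt_swap (V:=R_CompleteNormedModule)) by now apply ex_RInt_swap.
    change (opp (RInt f b a)) with (- RInt f b a).
    rewrite Rabs_Ropp, (Rabs_left (b - a)) by lra.
    replace (- (b - a)) with (a - b) by ring.
    apply abs_RInt_le_const; auto; try lra. now apply ex_RInt_swap. }
rewrite (below_Chasles Y s0 s).
replace (below s0 Y + RInt (clearance Y) s0 s - below s0 Y0)
  with (RInt (clearance Y) s0 s + (below s0 Y - below s0 Y0)) by ring.
eapply Rle_trans; [apply Rabs_triang|]. apply Rplus_le_compat.
- apply B; [|apply clearance_RInt]. intros t. rewrite Rabs_pos_eq by apply clearance_ge0.
  pose proof (tau_ge0 t). pose proof (Rle_abs Y0). pose proof (Rabs_pos Y0).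
  apply Rabs_le_between in HY.
  unfold clearance, Rmax. destruct Rle_dec; lra.
- unfold below.
  replace (RInt (clearance Y) 0 s0 - RInt (clearance Y0) 0 s0)
    with (RInt (fun t => clearance Y t - clearance Y0 t) 0 s0).
  2:{ apply (RInt_minus (V:=R_CompleteNormedModule)); apply clearance_RInt. }
  rewrite <- (Rminus_0_r s0) at 2. apply B.
  + intros t. unfold clearance, Rmax, Rabs.
    destruct Rle_dec, Rle_dec, Rcase_abs, Rcase_abs; lra.
  + apply (ex_RInt_minus (V:=R_CompleteNormedModule)); apply clearance_RInt.
Qed.

Lemma below_continuous s Y : continuity_2d_pt below s Y.
Proof.
intros eps. pose proof (cond_pos eps) as He.
set (K := Rabs Y + 1 + Rabs s).
assert (HK : 0 < K). { unfold K. pose proof (Rabs_pos Y). pose proof (Rabs_pos s). lra. }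
assert (Hd : 0 < Rmin 1 (eps / K)).
{ apply Rmin_glb_lt; [lra|]. now apply Rdiv_lt_0_compat. }
exists (mkposreal _ Hd); simpl; intros u v Hu Hv.
pose proof (Rmin_l 1 (eps / K)). pose proof (Rmin_r 1 (eps / K)).
eapply Rle_lt_trans; [apply below_lipschitz; lra|].
assert (E : eps = K * (eps / K) :> R) by (field; lra).
rewrite E. set (d := eps / K) in *.
unfold K. pose proof (Rabs_pos Y). pose proof (Rabs_pos s).
pose proof (Rabs_pos (u - s)). pose proof (Rabs_pos (v - Y)). nra.
Qed.

Lemma below_T_gt0 Y : 0 < Y -> 0 < below T Y.
Proof.
intros HY. pose proof (below_mono Y 0 T). rewrite below_0 in *.
destruct (Req_dec (below T Y) 0) as [Z|Z]; [|lra].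
rewrite <- (below_0 Y) in Z. symmetry in Z.
pose proof (below_eq_inv _ _ _ Z 0). lra.
Qed.

(** The last time with [below t Y <= c] is the right one: if [tau] exceeded [Y] there, [below] would
    stay constant a little longer. Thus the time found has [tau s <= Y], so that its radius reaches
    the level [Y]. *)
Lemma below_surj Y c : 0 < Y -> 0 <= c < below T Y ->
  exists s, 0 <= s < T /\ tau s <= Y /\ below s Y = c.
Proof.
intros HY Hc.
set (S := fun t => 0 <= t <= T /\ below t Y <= c).
destruct (completeness S) as [s [U L]].
{ exists T. intros t [Ht _]; lra. }
{ exists 0. split; [lra|]. rewrite below_0. lra. }
assert (s0 : 0 <= s). { apply U. split; [lra|]. rewrite below_0; lra. }
assert (sT : s <= T). { apply L. intros t [Ht _]; lra. }
assert (C : forall eps : posreal, exists d : posreal, forall t,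
   Rabs (t - s) < d -> Rabs (below t Y - below s Y) < eps).
{ intros eps. destruct (below_continuous s Y eps) as [d Hd]. exists d. intros t Ht.
  apply Hd; auto. rewrite Rminus_diag, Rabs_R0. apply cond_pos. }
assert (Lc : below s Y <= c).
{ apply Rnot_lt_le; intros G.
  assert (P : 0 < below s Y - c) by lra.
  destruct (C (mkposreal _ P)) as [d Hd]; simpl in Hd.
  assert (s <= s - d / 2); [|pose proof (cond_pos d); lra].
  apply L. intros t Ht. apply Rnot_lt_le; intros G'. specialize (U t Ht). destruct Ht as [Ht1 Ht2].
  assert (A : Rabs (t - s) < d) by (apply Rabs_def1; lra).
  apply Hd, Rabs_def2 in A. lra. }
assert (sT' : s < T).
{ apply Rnot_le_lt; intros G. assert (s = T) by lra. subst s. lra. }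
exists s. split; [lra|]. split.
- apply Rnot_lt_le; intros G.
  assert (P : locally s (fun x => Y < tau x)).
  { apply (tau_cont s (fun y => Y < y)). apply (open_gt Y); exact G. }
  destruct P as [d Hd]. pose proof (cond_pos d).
  set (q := Rmin T (s + d / 2)).
  assert (s < q /\ q <= T /\ q <= s + d / 2).
  { unfold q, Rmin; destruct Rle_dec; lra. }
  assert (q <= s); [|lra]. apply U. split; [lra|].
  rewrite <- (below_const Y s q); [lra|lra|]. intros t Ht. left. apply Hd.
  apply Rabs_def1; unfold minus, plus, opp; simpl; lra.
- apply Rle_antisym; [exact Lc|]. apply Rnot_lt_le; intros G.
  assert (P : 0 < c - below s Y) by lra.
  destruct (C (mkposreal _ P)) as [d Hd]; simpl in Hd. pose proof (cond_pos d).
  set (q := Rmin T (s + d / 2)).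
  assert (s < q /\ q <= T /\ q <= s + d / 2).
  { unfold q, Rmin; destruct Rle_dec; lra. }
  assert (q <= s); [|lra]. apply U. split; [lra|].
  assert (A : Rabs (q - s) < d) by (apply Rabs_def1; lra).
  apply Hd, Rabs_def2 in A. lra.
Qed.

(** The level decreases strictly along each radius from [M] at the centre, the north pole, to
    [tau s] on the boundary. Level [0] is attained only at the root of the tree, the south pole. *)
Definition level (s rho : R) : R := rho * tau s + (1 - rho) * M.
Definition altitude (s rho : R) : R := 2 * level s rho / M - 1.
Definition radius (s rho : R) : R := sqrt (1 - altitude s rho ^ 2).
Definition longitude (s rho : R) : R :=
  2 * PI * (below s (level s rho) / below T (level s rho)).

Definition sphere_map (s rho : R) : pt3 :=
  (radius s rho * cos (longitude s rho), radius s rho * sin (longitude s rho),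
   altitude s rho).

Lemma level_bound s rho : 0 <= rho <= 1 -> 0 <= level s rho <= M.
Proof. intros H. unfold level. pose proof (tau_ge0 s). pose proof (tau_lt s). nra. Qed.

Lemma altitude_level s rho : level s rho = M * (altitude s rho + 1) / 2.
Proof. unfold altitude. field. lra. Qed.

Lemma radius_sqr s rho : 0 <= rho <= 1 -> radius s rho ^ 2 = 1 - altitude s rho ^ 2.
Proof.
intros H. unfold radius. apply pow2_sqrt.
pose proof (level_bound s rho H) as L. rewrite altitude_level in L.
assert (-1 <= altitude s rho <= 1) by nra. nra.
Qed.

Lemma radius_gt0 s rho : 0 < level s rho < M -> 0 < radius s rho.
Proof.
intros L. apply sqrt_lt_R0. rewrite altitude_level in L.
assert (-1 < altitude s rho < 1) by nra. nra.
Qed.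

Lemma radius_eq0 s rho : level s rho = 0 \/ level s rho = M -> radius s rho = 0.
Proof.
intros L. unfold radius, altitude.
replace (1 - (2 * level s rho / M - 1) ^ 2) with 0; [apply sqrt_0|].
destruct L as [-> | ->]; field; lra.
Qed.

Lemma sphere_map_sphere s rho : 0 <= rho <= 1 -> sphere2 (sphere_map s rho).
Proof.
intros H. unfold sphere2, sphere_map; cbn [fst snd].
pose proof (radius_sqr s rho H). pose proof (sin2_cos2 (longitude s rho)) as E.
unfold Rsqr in E.
replace ((radius s rho * cos (longitude s rho)) ^ 2 + (radius s rho * sin (longitude s rho)) ^ 2)
  with (radius s rho ^ 2 * (sin (longitude s rho) * sin (longitude s rho) +
     cos (longitude s rho) * cos (longitude s rho))) by ring.
rewrite E. lra.
Qed.

Lemma sphere_map_surj p : sphere2 p ->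
  exists s rho, 0 <= s <= T /\ 0 <= rho <= 1 /\ sphere_map s rho = p.
Proof.
destruct p as [[x y] z]. unfold sphere2; cbn [fst snd]. intros H.
assert (Hz : -1 <= z <= 1) by nra.
set (Y := M * (z + 1) / 2).
assert (HY : 0 <= Y <= M) by (unfold Y; nra).
destruct (Req_dec Y M) as [EM|NM].
{ assert (z = 1) by (unfold Y in EM; nra). subst z.
  assert (x = 0 /\ y = 0) as [-> ->] by nra.
  exists 0, 0. split; [lra|split; [lra|]]. unfold sphere_map.
  assert (L : level 0 0 = M) by (unfold level; ring).
  rewrite (radius_eq0 0 0) by auto. unfold altitude. rewrite L.
  f_equal; [f_equal; ring|field; lra]. }
destruct (Req_dec Y 0) as [E0|N0].
{ assert (z = -1) by (unfold Y in E0; nra). subst z.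
  assert (x = 0 /\ y = 0) as [-> ->] by nra.
  exists 0, 1. split; [lra|split; [lra|]]. unfold sphere_map.
  assert (L : level 0 1 = 0) by (unfold level; rewrite tau_0; ring).
  rewrite (radius_eq0 0 1) by auto. unfold altitude. rewrite L.
  f_equal; [f_equal; ring|field; lra]. }
assert (Hz' : -1 < z < 1).
{ split; apply Rnot_le_lt; intros C; [apply N0|apply NM]; unfold Y; nra. }
set (r := sqrt (1 - z ^ 2)).
assert (Hr : 0 < r) by (apply sqrt_lt_R0; nra).
assert (Hr2 : r ^ 2 = 1 - z ^ 2) by (apply pow2_sqrt; nra).
destruct (polar_unit (x / r) (y / r)) as (th & Hth & Hc & Hs).
{ replace ((x / r) ^ 2 + (y / r) ^ 2) with ((x ^ 2 + y ^ 2) / r ^ 2) by (field; lra).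
  rewrite Hr2. replace (x ^ 2 + y ^ 2) with (1 - z ^ 2) by lra. field. nra. }
pose proof PI_RGT_0 as Hpi. pose proof (below_T_gt0 Y ltac:(lra)) as HT.
destruct (below_surj Y (th / (2 * PI) * below T Y)) as (s & Ss & Sl & Sb); [lra| |].
{ assert (0 <= th / (2 * PI) < 1); [|nra].
  split; [apply Rmult_le_pos; [lra|left; apply Rinv_0_lt_compat; lra]|].
  apply (Rmult_lt_reg_r (2 * PI)); [lra|]. field_simplify; lra. }
pose proof (tau_lt s) as Ht.
(* The fraction of the radius at which the level is [Y]; it is at most [1] because [tau s <= Y]. *)
exists s, ((M - Y) / (M - tau s)). split; [lra|].
assert (L : level s ((M - Y) / (M - tau s)) = Y) by (unfold level; field; lra).
split.
{ split; [apply Rmult_le_pos; [lra|left; apply Rinv_0_lt_compat; lra]|].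
  apply (Rmult_le_reg_r (M - tau s)); [lra|]. field_simplify; lra. }
assert (A : altitude s ((M - Y) / (M - tau s)) = z).
{ unfold altitude. rewrite L. unfold Y. field. lra. }
unfold sphere_map, radius, longitude. rewrite A, L, Sb. fold r.
replace (2 * PI * (th / (2 * PI) * below T Y / below T Y)) with th by (field; lra).
rewrite Hc, Hs. f_equal. f_equal; field; lra.
Qed.

(** Besides equal longitudes there is the case of a full turn, which is the seam. There [below] is
    constant on [[0, s]] and on [[s', T]]; unless these are single points, [tau] would be at least
    [Y > 0] at [0] or at [T], where it vanishes. The poles are separated off beforehand, since the
    longitude carries no information there. *)
Lemma sphere_map_inj_le s s' rho rho' :
  0 <= s -> s <= s' -> s' <= T -> 0 <= rho <= 1 -> 0 <= rho' <= 1 ->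
  sphere_map s rho = sphere_map s' rho' ->
  (rho = 0 /\ rho' = 0) \/ (s = s' /\ rho = rho') \/ (s = 0 /\ s' = T /\ rho = rho') \/
  (rho = 1 /\ rho' = 1 /\ same_point tau s s').
Proof.
intros H0 Hss HT Hr Hr' H.
assert (A : altitude s rho = altitude s' rho') by exact (f_equal snd H).
assert (L : level s rho = level s' rho') by now rewrite !altitude_level, A.
pose proof (tau_ge0 s); pose proof (tau_ge0 s'); pose proof (tau_lt s); pose proof (tau_lt s').
pose proof (level_bound s rho Hr) as B.
destruct (Req_dec (level s rho) M) as [EM|NM].
{ left. rewrite L in EM. pose proof EM as EM'. rewrite <- L in EM. unfold level in EM, EM'.
  split; nra. }
destruct (Req_dec (level s rho) 0) as [E0|N0].
{ right; right; right. pose proof E0 as E0'. rewrite L in E0'. unfold level in E0, E0'.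
  assert (rho = 1) by nra. assert (rho' = 1) by nra. subst.
  split; [auto|split; [auto|]]. split; [lra|]. intros x _. pose proof (tau_ge0 x). lra. }
set (Y := level s rho) in *.
assert (HY : 0 < Y < M) by lra.
pose proof (radius_gt0 s rho ltac:(fold Y; lra)) as Pr.
assert (ER : radius s rho = radius s' rho') by (unfold radius; now rewrite A).
pose proof (f_equal (fun p => fst (fst p)) H) as Ec.
pose proof (f_equal (fun p => snd (fst p)) H) as Es.
unfold sphere_map in Ec, Es; cbn [fst snd] in Ec, Es. rewrite <- ER in Ec, Es.
apply Rmult_eq_reg_l in Ec, Es; [|lra..].
pose proof (below_T_gt0 Y ltac:(lra)) as PT. pose proof PI_RGT_0 as Hpi.
unfold longitude in Ec, Es. rewrite <- L in Ec, Es. fold Y in Ec, Es.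
set (c := below s Y / below T Y) in *. set (c' := below s' Y / below T Y) in *.
assert (Bs : below s Y = c * below T Y) by (unfold c; field; lra).
assert (Bs' : below s' Y = c' * below T Y) by (unfold c'; field; lra).
pose proof (below_mono Y 0 s H0) as M1. pose proof (below_mono Y s s' Hss) as M2.
pose proof (below_mono Y s' T HT) as M3. rewrite below_0 in M1.
assert (Hcc : 0 <= c /\ c <= c' /\ c' <= 1) by nra.
destruct (Req_dec c c') as [Ecc|Ncc].
- assert (Eb : below s Y = below s' Y) by (rewrite Bs, Bs', Ecc; reflexivity).
  destruct (Req_dec s s') as [<-|Ns].
  + right; left. split; [auto|]. unfold Y, level in L. nra.
  + right; right; right.
    assert (G : forall t, s <= t <= s' -> Y <= tau t).
    { intros t Ht. apply (below_eq_inv Y s s'); auto; lra. }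
    pose proof (G s ltac:(lra)) as G1. pose proof (G s' ltac:(lra)) as G2.
    assert (rho = 1) by (unfold Y, level in G1; nra).
    assert (rho' = 1) by (rewrite L in G2; unfold level in G2; nra).
    subst rho rho'. unfold Y, level in *. split; [auto|split; [auto|]].
    split; [lra|]. intros x [Hx|Hx]; [specialize (G x Hx); lra|].
    replace x with s by lra. lra.
- right; right; left.
  (* Different longitudes in [[0, 2 pi]] with the same cosine and sine can only be the two ends of
     this interval. *)
  assert (c = 0 /\ c' = 1) as [C0 C1].
  { destruct (Req_dec c 0) as [Z|Z], (Req_dec c' 1) as [Z'|Z']; auto; exfalso; apply Ncc;
    apply (Rmult_eq_reg_l (2 * PI)); try lra; apply cos_sin_inj; auto;
    apply Rabs_def1; nra. }
  assert (Es0 : s = 0).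
  { destruct (Req_dec s 0); auto. assert (E : below 0 Y = below s Y) by (rewrite below_0, Bs, C0; ring).
    pose proof (below_eq_inv Y 0 s E 0). lra. }
  assert (EsT : s' = T).
  { destruct (Req_dec s' T); auto.
    assert (E : below s' Y = below T Y) by (rewrite Bs', C1; ring).
    pose proof (below_eq_inv Y s' T E T). lra. }
  subst s s'. split; [auto|split; [auto|]].
  unfold Y, level in L. rewrite tau_0, tau_T in L. nra.
Qed.

Lemma sphere_map_fibre s s' rho rho' :
  0 <= s <= T -> 0 <= s' <= T -> 0 <= rho <= 1 -> 0 <= rho' <= 1 ->
  sphere_map s rho = sphere_map s' rho' ->
  (rho = 0 /\ rho' = 0) \/ (s = s' /\ rho = rho') \/
  (rho = rho' /\ ((s = 0 /\ s' = T) \/ (s = T /\ s' = 0))) \/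
  (rho = 1 /\ rho' = 1 /\ same_point tau s s').
Proof.
intros H1 H2 H3 H4 H. destruct (Rle_dec s s').
- destruct (sphere_map_inj_le s s' rho rho') as [?|[?|[?|?]]]; auto; try lra; tauto.
- symmetry in H.
  destruct (sphere_map_inj_le s' s rho' rho) as [C|[C|[C|(? & ? & C)]]]; auto; try lra.
  all: try (apply same_point_sym in C; tauto).
Qed.

Lemma sphere_map_pole s s' : sphere_map s 0 = sphere_map s' 0.
Proof.
assert (L : forall s, level s 0 = M) by (intros; unfold level; ring).
unfold sphere_map. rewrite !radius_eq0 by (right; apply L). unfold altitude. rewrite !L.
f_equal. f_equal; ring.
Qed.

Lemma sphere_map_seam rho : 0 <= rho <= 1 -> sphere_map 0 rho = sphere_map T rho.
Proof.
intros Hr. assert (L : level 0 rho = level T rho) by (unfold level; now rewrite tau_0, tau_T).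
assert (A : altitude 0 rho = altitude T rho) by (unfold altitude; now rewrite L).
unfold sphere_map. rewrite A. f_equal.
pose proof (level_bound 0 rho Hr) as B.
destruct (Req_dec (level 0 rho) 0) as [Z|Z].
- rewrite (radius_eq0 0), (radius_eq0 T) by (rewrite <- ?L; auto). f_equal; ring.
- assert (ER : radius 0 rho = radius T rho) by (unfold radius; now rewrite A).
  rewrite ER. unfold longitude. rewrite <- L, below_0.
  pose proof (below_T_gt0 (level 0 rho) ltac:(lra)).
  replace (2 * PI * (0 / below T (level 0 rho))) with 0 by (field; lra).
  replace (2 * PI * (below T (level 0 rho) / below T (level 0 rho))) with (2 * PI) by (field; lra).
  now rewrite cos_0, sin_0, cos_2PI, sin_2PI.
Qed.

Lemma sphere_map_same_point s s' : same_point tau s s' -> sphere_map s 1 = sphere_map s' 1.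
Proof.
assert (W : forall s s', s <= s' -> same_point tau s s' -> sphere_map s 1 = sphere_map s' 1).
{ clear s s'; intros s s' Hss [E H].
  assert (L : level s 1 = tau s) by (unfold level; ring).
  assert (L' : level s' 1 = tau s) by (unfold level; rewrite E; ring).
  unfold sphere_map, radius, longitude, altitude. rewrite L, L'.
  rewrite (below_const (tau s) s s'); auto. }
intros H. destruct (Rle_dec s s'); [auto|]. symmetry; apply W; [lra|now apply same_point_sym].
Qed.

(** * Continuity of the sphere map *)

Lemma level_continuous s rho : continuity_2d_pt level s rho.
Proof.
apply continuity_2d_pt_plus; apply continuity_2d_pt_mult.
- apply continuity_2d_pt_id2.
- apply (continuity_1d_2d_pt_comp tau (fun u _ => u)); [|apply continuity_2d_pt_id1].
  apply continuity_pt_filterlim, tau_cont.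
- apply continuity_2d_pt_minus; [apply continuity_2d_pt_const|apply continuity_2d_pt_id2].
- apply continuity_2d_pt_const.
Qed.

Lemma altitude_continuous s rho : continuity_2d_pt altitude s rho.
Proof.
unfold altitude, Rdiv.
apply continuity_2d_pt_minus; [|apply continuity_2d_pt_const].
apply continuity_2d_pt_mult; [|apply continuity_2d_pt_const].
apply continuity_2d_pt_mult; [apply continuity_2d_pt_const|apply level_continuous].
Qed.

Lemma radius_continuous s rho : continuity_2d_pt radius s rho.
Proof.
apply (continuity_1d_2d_pt_comp sqrt); [apply continuity_pt_filterlim, continuous_sqrt|].
apply continuity_2d_pt_minus; [apply continuity_2d_pt_const|].
apply (continuity_1d_2d_pt_comp (fun x => x ^ 2)); [reg|apply altitude_continuous].
Qed.

Lemma below_level_continuous s rho (f : R -> R -> R) : continuity_2d_pt f s rho ->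
  continuity_2d_pt (fun u v => below (f u v) (level u v)) s rho.
Proof.
intros Hf. apply continuity_2d_pt_filterlim.
apply (filterlim_comp_2 (fun z => f (fst z) (snd z)) (fun z => level (fst z) (snd z)) below
         (G := locally (f s rho)) (H := locally (level s rho))).
- apply continuity_2d_pt_filterlim, Hf.
- apply continuity_2d_pt_filterlim, level_continuous.
- pose proof (below_continuous (f s rho) (level s rho)) as C.
  apply continuity_2d_pt_filterlim in C.
  intros P HP. specialize (C P HP). destruct C as [e He].
  exists (fun x => ball (f s rho) e x) (fun y => ball (level s rho) e y);
    [apply locally_ball|apply locally_ball|].
  intros x y Hx Hy. apply (He (x, y)). split; assumption.
Qed.

(** Near the south pole the longitude is discontinuous but is multiplied by a vanishing radius. *)
Lemma wheel_continuous (f : R -> R) s rho :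
  (forall x, continuity_pt f x) -> (forall x, Rabs (f x) <= 1) -> 0 <= rho <= 1 ->
  continuity_2d_pt (fun u v => radius u v * f (longitude u v)) s rho.
Proof.
intros Cf Bf Hr. pose proof (level_bound s rho Hr) as B.
destruct (Req_dec (level s rho) 0) as [Z|Z].
- intros eps. destruct (radius_continuous s rho eps) as [d Hd]. exists d. intros u v Hu Hv.
  specialize (Hd u v Hu Hv). rewrite (radius_eq0 s rho) in * by auto.
  rewrite Rmult_0_l, Rminus_0_r in *. rewrite Rabs_mult.
  pose proof (Rabs_pos (radius u v)). pose proof (Rabs_pos (f (longitude u v))).
  pose proof (Bf (longitude u v)). nra.
- apply continuity_2d_pt_mult; [apply radius_continuous|].
  apply (continuity_1d_2d_pt_comp f); [apply Cf|].
  unfold longitude, Rdiv.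
  apply continuity_2d_pt_mult; [apply continuity_2d_pt_const|].
  apply continuity_2d_pt_mult.
  + apply below_level_continuous, continuity_2d_pt_id1.
  + apply continuity_2d_pt_inv.
    * apply below_level_continuous, continuity_2d_pt_const.
    * pose proof (below_T_gt0 (level s rho)). lra.
Qed.
End SphereMap.

(** * The star polygon *)

Section EqualEdges.
Variables (n : nat) (v : nat -> pt) (l : R).
Hypothesis n_gt0 : (0 < n)%nat.
Hypothesis edge_gt0 : 0 < l.
Hypothesis elenE : forall i, elen n v i = l.

Lemma cumE i : cum n v i = INR i * l.
Proof.
induction i as [|i IH]; cbn [cum]; [simpl; ring|]. rewrite IH, elenE, S_INR. ring.
Qed.

Lemma perimeterE : perimeter n v = INR n * l.
Proof. apply cumE. Qed.

Lemma perimeter_gt0 : 0 < perimeter n v.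
Proof. rewrite perimeterE. apply Rmult_lt_0_compat; auto. now apply lt_0_INR. Qed.

Definition edge_point (i : nat) (u : R) : pt :=
  (fst (V n v i) + u * (fst (V n v (S i)) - fst (V n v i)),
   snd (V n v i) + u * (snd (V n v (S i)) - snd (V n v i))).

Lemma seg_ptE k i0 i u : (i0 <= i < i0 + k)%nat -> 0 <= u <= 1 ->
  seg_pt n v k i0 (l * (INR i + u)) = edge_point i u.
Proof.
revert i0; induction k as [|k IH]; intros i0 Hi Hu; [lia|].
change (seg_pt n v (S k) i0 (l * (INR i + u))) with
  (if Rle_dec (l * (INR i + u)) (cum n v (S i0)) then Defs.interp n v i0 (l * (INR i + u))
   else seg_pt n v k (S i0) (l * (INR i + u))).
destruct Rle_dec as [L|L]; rewrite (cumE (S i0)), S_INR in L.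
- unfold Defs.interp. rewrite cumE, elenE.
  assert (C : INR i + u <= INR i0 + 1) by nra.
  destruct (Nat.eq_dec i i0) as [->|Hne].
  + replace ((l * (INR i0 + u) - INR i0 * l) / l) with u by (field; lra). reflexivity.
  (* The search stops before edge [i] only at a vertex, [u = 0]: it then returns the end of the
     preceding edge instead of the start of this one, which is the same point. *)
  + assert (INR (S i0) <= INR i) as G by (apply le_INR; lia). rewrite S_INR in G.
    assert (i = S i0) as ->.
    { apply Nat.le_antisymm; [|lia]. apply INR_le. rewrite S_INR. lra. }
    rewrite S_INR in *. assert (u = 0) as -> by lra.
    unfold edge_point. replace ((l * (INR i0 + 1 + 0) - INR i0 * l) / l) with 1 by (field; lra).
    f_equal; ring.
- apply IH; auto. assert (i <> i0); [|lia]. intros ->. apply L. nra.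
Qed.

Lemma rmod_id s : 0 <= s < perimeter n v -> rmod n v s = s.
Proof.
intros H. pose proof perimeter_gt0 as P. unfold rmod.
rewrite <- (Int_part_spec (s / perimeter n v) 0); [ring|].
assert (0 <= s / perimeter n v < 1); [|lra].
split; [apply Rmult_le_pos; [lra|left; now apply Rinv_0_lt_compat]|].
apply (Rmult_lt_reg_r (perimeter n v)); [lra|]. field_simplify; lra.
Qed.

Lemma rmod_range s : 0 <= rmod n v s < perimeter n v.
Proof.
pose proof perimeter_gt0 as P. unfold rmod.
destruct (base_Int_part (s / perimeter n v)) as [B1 B2].
set (z := IZR (Int_part (s / perimeter n v))) in *.
assert (E : s = perimeter n v * (s / perimeter n v)) by (field; lra).
set (q := s / perimeter n v) in *. rewrite E. nra.
Qed.

Lemma gamma_rmod s : gamma n v s = gamma n v (rmod n v s).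
Proof. unfold gamma. now rewrite (rmod_id (rmod n v s)) by apply rmod_range. Qed.

Lemma gamma_perimeter : gamma n v (perimeter n v) = gamma n v 0.
Proof.
unfold gamma. pose proof perimeter_gt0 as P. f_equal. unfold rmod.
rewrite <- (Int_part_spec (perimeter n v / perimeter n v) 1), <- (Int_part_spec (0 / perimeter n v) 0).
- ring.
- replace (0 / perimeter n v) with 0 by (field; lra). lra.
- replace (perimeter n v / perimeter n v) with 1 by (field; lra). lra.
Qed.

Lemma gammaE i u : (i < n)%nat -> 0 <= u <= 1 -> gamma n v (l * (INR i + u)) = edge_point i u.
Proof.
intros Hi Hu.
assert (W : forall i u, (i < n)%nat -> 0 <= u < 1 -> gamma n v (l * (INR i + u)) = edge_point i u).
{ clear i u Hi Hu. intros i u Hi Hu. unfold gamma. rewrite rmod_id, seg_ptE; auto; [lia|lra|].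
  rewrite perimeterE. pose proof (pos_INR i).
  assert (INR (S i) <= INR n) as G by (apply le_INR; lia). rewrite S_INR in G. split; nra. }
destruct (Req_dec u 1) as [->|Hne]; [|apply W; auto; lra].
assert (E : edge_point i 1 = V n v (S i)).
{ unfold edge_point. rewrite (surjective_pairing (V n v (S i))). simpl; f_equal; ring. }
rewrite E.
assert (E0 : forall j, edge_point j 0 = V n v j).
{ intros j. unfold edge_point. rewrite (surjective_pairing (V n v j)). simpl; f_equal; ring. }
destruct (Nat.eq_dec (S i) n) as [En|Hn].
- replace (l * (INR i + 1)) with (perimeter n v) by (rewrite perimeterE, <- En, S_INR; ring).
  rewrite gamma_perimeter. replace 0 with (l * (INR 0 + 0)) by (simpl; ring).
  rewrite W by (auto; lra). rewrite E0. unfold V. rewrite En.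
  now rewrite Nat.Div0.mod_same, Nat.Div0.mod_0_l.
- replace (l * (INR i + 1)) with (l * (INR (S i) + 0)) by (rewrite S_INR; ring).
  rewrite W by (try lia; lra). apply E0.
Qed.

Lemma gamma_vertex i : (i < n)%nat -> gamma n v (l * INR i) = V n v i.
Proof.
intros Hi. replace (l * INR i) with (l * (INR i + 0)) by ring. rewrite gammaE by (auto; lra).
unfold edge_point. rewrite (surjective_pairing (V n v i)). simpl; f_equal; ring.
Qed.
End EqualEdges.

Lemma unit_decompose (m : nat) t : 0 <= t < INR m ->
  exists i u, (i < m)%nat /\ 0 <= u < 1 /\ t = INR i + u.
Proof.
intros H. destruct (nfloor_ex t) as [i Hi]; [lra|].
exists i, (t - INR i). split; [|split; lra]. apply INR_lt. lra.
Qed.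

(** * Vectors in polar form and the angles between them *)

Definition unit_vec (th : R) : pt := (cos th, sin th).
Definition scale (c : R) (p : pt) : pt := (c * fst p, c * snd p).

Lemma cross_scale a b x y :
  cross (scale a (unit_vec x)) (scale b (unit_vec y)) = a * b * sin (y - x).
Proof. unfold cross; simpl. rewrite sin_minus. ring. Qed.

Lemma dot_scale a b x y :
  dot (scale a (unit_vec x)) (scale b (unit_vec y)) = a * b * cos (x - y).
Proof. unfold dot; simpl. rewrite cos_minus. ring. Qed.

Lemma norm2_scale a x : norm2 (scale a (unit_vec x)) = Rabs a.
Proof.
unfold norm2; simpl. rewrite <- sqrt_Rsqr_abs. f_equal.
pose proof (sin2_cos2 x) as H. unfold Rsqr in *.
transitivity (a * a * (sin x * sin x + cos x * cos x)); [ring|]. rewrite H. ring.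
Qed.

Lemma ccw_angle_scale a x th : a <> 0 -> 0 < th < PI ->
  ccw_angle (scale a (unit_vec x)) (scale a (unit_vec (x + th))) = th.
Proof.
intros Ha Ht. unfold ccw_angle. rewrite cross_scale, dot_scale, !norm2_scale.
assert (Rabs a * Rabs a = a * a) as -> by (rewrite <- Rabs_mult; apply Rabs_pos_eq; nra).
replace (x + th - x) with th by ring. replace (x - (x + th)) with (- th) by ring.
rewrite cos_neg. replace (a * a * cos th / (a * a)) with (cos th) by (field; auto).
rewrite acos_cos by lra. pose proof (sin_gt_0 th). destruct Rle_dec; nra.
Qed.

Lemma ccw_angle_scale_neg a x th : a <> 0 -> 0 < th < PI ->
  ccw_angle (scale a (unit_vec (x + th))) (scale a (unit_vec x)) = 2 * PI - th.
Proof.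
intros Ha Ht. unfold ccw_angle. rewrite cross_scale, dot_scale, !norm2_scale.
assert (Rabs a * Rabs a = a * a) as -> by (rewrite <- Rabs_mult; apply Rabs_pos_eq; nra).
replace (x + th - x) with th by ring. replace (x - (x + th)) with (- th) by ring.
rewrite sin_neg. replace (a * a * cos th / (a * a)) with (cos th) by (field; auto).
rewrite acos_cos by lra.
assert (0 < a * a * sin th).
{ apply Rmult_lt_0_compat; [nra|]. apply sin_gt_0; lra. }
destruct Rle_dec; lra.
Qed.

Lemma sin_cos_prod a b : sin a * cos b = (sin (a + b) + sin (a - b)) / 2.
Proof. rewrite sin_plus, sin_minus. field. Qed.

Lemma sin_sin_prod a b : sin a * sin b = (cos (a - b) - cos (a + b)) / 2.
Proof. rewrite cos_plus, cos_minus. field. Qed.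

Section Star.
Variable k : nat.
Hypothesis k_ge4 : (4 <= k)%nat.

(** Both the angle of a tip and the angle at the centre between consecutive vertices. *)
Definition step : R := PI / INR k.
(** Law of sines in the triangle formed by the centre, a reflex vertex and a neighbouring tip,
    scaled to circumdiameter [1]. Its angles are [step] at the centre, [step / 2] at the tip and
    [pi - 3 * step / 2] at the reflex vertex, so the side opposite the centre, an edge of the star,
    is [sin step]. *)
Definition reach (i : nat) : R := if Nat.even i then sin (step / 2) else sin (3 * step / 2).
Definition star_vertex (i : nat) : pt := scale (reach i) (unit_vec (INR i * step)).

Notation n := (2 * k)%nat.
Notation l := (sin step).

Lemma k_step : INR k * step = PI.
Proof. unfold step. field. apply not_0_INR. lia. Qed.

Lemma step_bound : 0 < step /\ 4 * step <= PI.
Proof.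
assert (4 <= INR k) by (replace 4 with (INR 4) by (simpl; ring); now apply le_INR).
pose proof PI_RGT_0. pose proof k_step.
assert (0 < step) by (apply Rdiv_lt_0_compat; lra). split; [auto|nra].
Qed.

Lemma edge_gt0 : 0 < l.
Proof. pose proof step_bound. apply sin_gt_0; lra. Qed.

Lemma reach_gt0 i : 0 < reach i.
Proof. pose proof step_bound. unfold reach. destruct Nat.even; apply sin_gt_0; lra. Qed.

Lemma unit_vec_period x (q : nat) : unit_vec (x + 2 * INR q * PI) = unit_vec x.
Proof. unfold unit_vec. now rewrite cos_period, sin_period. Qed.

Lemma star_period i q : star_vertex (i + n * q) = star_vertex i.
Proof.
unfold star_vertex, reach. rewrite Nat.even_add, <- Nat.mul_assoc, Nat.even_mul. cbn [Nat.even orb].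
replace (Bool.eqb (Nat.even i) true) with (Nat.even i) by now destruct Nat.even.
f_equal. rewrite plus_INR, !mult_INR, Rmult_plus_distr_r.
replace (INR 2 * (INR k * INR q) * step) with (2 * INR q * (INR k * step)) by (simpl; ring).
rewrite k_step. apply unit_vec_period.
Qed.

Lemma V_star i : V n star_vertex i = star_vertex i.
Proof.
unfold V. rewrite (Nat.div_mod_eq i n) at 2. rewrite Nat.add_comm. symmetry. apply star_period.
Qed.

(** This formula and the one for odd [i] carry the metric geometry of the star: the common edge
    length and, from the directions of consecutive edges, the interior angles. Both come from the
    product-to-sum identities. *)
Lemma star_edge_even i : Nat.even i = true ->
  vsub (star_vertex (S i)) (star_vertex i) = scale l (unit_vec ((INR i + 3 / 2) * step)).
Proof.
intros H. unfold vsub, star_vertex, reach, scale, unit_vec; cbn [fst snd].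
rewrite Nat.even_succ, <- Nat.negb_even, H, S_INR; cbn [negb].
set (x := INR i). set (d := step).
rewrite !sin_cos_prod, !sin_sin_prod. f_equal.
- replace (3 * d / 2 + (x + 1) * d) with (d + (x + 3 / 2) * d) by field.
  replace (3 * d / 2 - (x + 1) * d) with (d / 2 - x * d) by field.
  replace (d - (x + 3 / 2) * d) with (- (d / 2 + x * d)) by field.
  rewrite sin_neg. field.
- replace (3 * d / 2 + (x + 1) * d) with (d + (x + 3 / 2) * d) by field.
  replace (3 * d / 2 - (x + 1) * d) with (d / 2 - x * d) by field.
  replace (d - (x + 3 / 2) * d) with (- (d / 2 + x * d)) by field.
  rewrite cos_neg. field.
Qed.

Lemma star_edge_odd i : Nat.even i = false ->
  vsub (star_vertex (S i)) (star_vertex i) = scale (- l) (unit_vec ((INR i - 1 / 2) * step)).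
Proof.
intros H. unfold vsub, star_vertex, reach, scale, unit_vec; cbn [fst snd].
rewrite Nat.even_succ, <- Nat.negb_even, H, S_INR; cbn [negb].
set (x := INR i). set (d := step).
rewrite <- !Ropp_mult_distr_l, !sin_cos_prod, !sin_sin_prod. f_equal.
- replace (d / 2 + (x + 1) * d) with (3 * d / 2 + x * d) by field.
  replace (d / 2 - (x + 1) * d) with (- (d + (x - 1 / 2) * d)) by field.
  replace (d - (x - 1 / 2) * d) with (3 * d / 2 - x * d) by field.
  rewrite sin_neg. field.
- replace (d / 2 + (x + 1) * d) with (3 * d / 2 + x * d) by field.
  replace (d / 2 - (x + 1) * d) with (- (d + (x - 1 / 2) * d)) by field.
  replace (d - (x - 1 / 2) * d) with (3 * d / 2 - x * d) by field.
  rewrite cos_neg. field.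
Qed.

Lemma vsub_swap p q c x : vsub p q = scale c (unit_vec x) -> vsub q p = scale (- c) (unit_vec x).
Proof.
unfold vsub, scale; cbn [fst snd]. intros H. injection H as H1 H2.
rewrite <- !Ropp_mult_distr_l. simpl in *. f_equal; lra.
Qed.

Lemma star_elen i : elen n star_vertex i = l.
Proof.
unfold elen. rewrite !V_star.
assert (D : forall p q, Defs.dist p q = norm2 (vsub p q)) by reflexivity.
assert (E : exists c x, Rabs c = l /\ vsub (star_vertex (S i)) (star_vertex i) = scale c (unit_vec x)).
{ pose proof edge_gt0. destruct (Nat.even i) eqn:Ei.
  - exists l, ((INR i + 3 / 2) * step). split; [apply Rabs_pos_eq; lra|now apply star_edge_even].
  - exists (- l), ((INR i - 1 / 2) * step).
    split; [rewrite Rabs_Ropp; apply Rabs_pos_eq; lra|now apply star_edge_odd]. }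
destruct E as (c & x & Hc & E). rewrite D, (vsub_swap _ _ _ _ E), norm2_scale, Rabs_Ropp. exact Hc.
Qed.

(** Consecutive vertices turn counterclockwise about the centre, so every summand is positive. The
    sign decides which of the two branches [interior_angle] takes. *)
Lemma star_shoelace : 0 < shoelace n star_vertex n.
Proof.
assert (P : forall m, 0 < shoelace n star_vertex (S m)).
{ assert (C : forall j, 0 < cross (V n star_vertex j) (V n star_vertex (S j))).
  { intros j. rewrite !V_star. unfold star_vertex. rewrite cross_scale, S_INR.
    replace ((INR j + 1) * step - INR j * step) with step by ring.
    pose proof (reach_gt0 j); pose proof (reach_gt0 (S j)); pose proof edge_gt0.
    apply Rmult_lt_0_compat; [nra|lra]. }
  induction m as [|m IH]; cbn [shoelace] in *.
  - specialize (C 0%nat). lra.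
  - specialize (C (S m)). lra. }
replace n with (S (2 * k - 1)) at 2 by lia. apply P.
Qed.

Lemma star_prev i : star_vertex (i + n - 1 + 1) = star_vertex i.
Proof. replace (i + n - 1 + 1)%nat with (i + n * 1)%nat by lia. apply star_period. Qed.

Lemma even_prev i : Nat.even (i + n - 1) = negb (Nat.even i).
Proof.
replace (i + n - 1)%nat with (i + (1 + 2 * (k - 1)))%nat by lia.
rewrite Nat.even_add, Nat.even_add, Nat.even_mul. now destruct (Nat.even i).
Qed.

Lemma INR_prev i : INR (i + n - 1) * step = (INR i - 1) * step + 2 * INR 1 * PI.
Proof.
rewrite minus_INR, plus_INR, mult_INR by lia. simpl (INR 1). simpl (INR 2).
rewrite <- k_step. ring.
Qed.

Lemma star_prev_even i : Nat.even i = true ->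
  vsub (star_vertex (i + n - 1)) (star_vertex i) = scale l (unit_vec ((INR i - 3 / 2) * step)).
Proof.
intros H. rewrite <- (star_prev i), Nat.add_1_r.
rewrite (vsub_swap _ _ _ _ (star_edge_odd _ ltac:(rewrite even_prev, H; reflexivity))).
rewrite Ropp_involutive. f_equal. rewrite Rmult_minus_distr_r, INR_prev.
rewrite <- (unit_vec_period ((INR i - 3 / 2) * step) 1). f_equal. field.
Qed.

Lemma star_prev_odd i : Nat.even i = false ->
  vsub (star_vertex (i + n - 1)) (star_vertex i) = scale (- l) (unit_vec ((INR i + 1 / 2) * step)).
Proof.
intros H. rewrite <- (star_prev i), Nat.add_1_r.
rewrite (vsub_swap _ _ _ _ (star_edge_even _ ltac:(rewrite even_prev, H; reflexivity))).
f_equal. rewrite Rmult_plus_distr_r, INR_prev.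
rewrite <- (unit_vec_period ((INR i + 1 / 2) * step) 1). f_equal. field.
Qed.

Lemma interior_angle_even i : Nat.even i = true ->
  interior_angle n star_vertex i = 2 * PI - 3 * step.
Proof.
intros H. pose proof step_bound. pose proof edge_gt0. unfold interior_angle.
destruct Rlt_dec as [_|C]; [|exfalso; apply C, star_shoelace].
rewrite !V_star, star_edge_even, star_prev_even by auto.
replace ((INR i + 3 / 2) * step) with ((INR i - 3 / 2) * step + 3 * step) by field.
apply ccw_angle_scale_neg; lra.
Qed.

Lemma interior_angle_odd i : Nat.even i = false -> interior_angle n star_vertex i = step.
Proof.
intros H. pose proof step_bound. pose proof edge_gt0. unfold interior_angle.
destruct Rlt_dec as [_|C]; [|exfalso; apply C, star_shoelace].
rewrite !V_star, star_edge_odd, star_prev_odd by auto.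
replace ((INR i + 1 / 2) * step) with ((INR i - 1 / 2) * step + step) by field.
apply ccw_angle_scale; lra.
Qed.

Lemma star_corner i :
  cross (vsub (V n star_vertex (S i)) (V n star_vertex i)) (vsub (V n star_vertex (i + n - 1)) (V n star_vertex i)) <> 0.
Proof.
rewrite !V_star. pose proof step_bound. pose proof edge_gt0.
destruct (Nat.even i) eqn:H'.
- rewrite star_edge_even, star_prev_even, cross_scale by auto.
  replace ((INR i - 3 / 2) * step - (INR i + 3 / 2) * step) with (- (3 * step)) by field.
  rewrite sin_neg. assert (0 < sin (3 * step)) by (apply sin_gt_0; lra).
  assert (0 < l * l * sin (3 * step)); [|lra]. apply Rmult_lt_0_compat; nra.
- rewrite star_edge_odd, star_prev_odd, cross_scale by auto.
  replace ((INR i + 1 / 2) * step - (INR i - 1 / 2) * step) with step by field.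
  assert (0 < l * l * l); [|lra]. repeat apply Rmult_lt_0_compat; lra.
Qed.

(** A combination of two directions [step] apart points into the sector between them. The strict
    sign of [A] excludes the second boundary ray, so the sectors are half-open and tile the full
    turn without overlap. *)
Lemma sector_polar i A B : 0 < A -> 0 <= B ->
  exists phi m, 0 <= phi < step /\ 0 < m /\
    A * cos (INR i * step) + B * cos (INR (S i) * step) = m * cos (INR i * step + phi) /\
    A * sin (INR i * step) + B * sin (INR (S i) * step) = m * sin (INR i * step + phi).
Proof.
intros HA HB. pose proof step_bound as [S1 S2]. pose proof edge_gt0 as L. pose proof PI_RGT_0.
assert (C : 0 < cos step) by (apply cos_gt_0; lra).
set (X := A + B * cos step). set (Y := B * l).
assert (HX : 0 < X) by (unfold X; nra). assert (HY : 0 <= Y) by (unfold Y; nra).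
set (m := sqrt (X ^ 2 + Y ^ 2)).
assert (Hm : 0 < m) by (apply sqrt_lt_R0; nra).
assert (Hm2 : m ^ 2 = X ^ 2 + Y ^ 2) by (apply pow2_sqrt; nra).
destruct (polar_unit (X / m) (Y / m)) as (phi & Hp & Hc & Hs).
{ replace ((X / m) ^ 2 + (Y / m) ^ 2) with ((X ^ 2 + Y ^ 2) / m ^ 2) by (field; lra).
  rewrite Hm2. field. nra. }
assert (Ec : m * cos phi = X) by (rewrite Hc; field; lra).
assert (Es : m * sin phi = Y) by (rewrite Hs; field; lra).
assert (P1 : phi <= PI).
{ apply Rnot_lt_le; intros G. assert (sin phi < 0) by (apply sin_lt_0; lra). nra. }
assert (P2 : phi < PI / 2).
{ apply Rnot_le_lt; intros G. assert (cos phi <= 0) by (apply cos_le_0; lra). nra. }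
assert (P3 : phi < step).
{ apply Rnot_le_lt; intros G.
  assert (S0 : 0 <= sin (phi - step)) by (apply sin_ge_0; lra).
  rewrite sin_minus in S0.
  assert (Q : 0 <= m * (sin phi * cos step - cos phi * l)) by (apply Rmult_le_pos; lra).
  replace (m * (sin phi * cos step - cos phi * l))
    with (m * sin phi * cos step - m * cos phi * l) in Q by ring.
  rewrite Ec, Es in Q. unfold X, Y in Q. nra. }
exists phi, m. split; [lra|split; [auto|]].
rewrite cos_plus, sin_plus, S_INR, Rmult_plus_distr_r, Rmult_1_l, cos_plus, sin_plus.
split.
- transitivity (cos (INR i * step) * X - sin (INR i * step) * Y); [unfold X, Y; ring|].
  rewrite <- Ec, <- Es. ring.
- transitivity (sin (INR i * step) * X + cos (INR i * step) * Y); [unfold X, Y; ring|].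
  rewrite <- Ec, <- Es. ring.
Qed.

Lemma edge_point_star rho i u :
  scale rho (edge_point n star_vertex i u) =
  (rho * (1 - u) * reach i * cos (INR i * step) + rho * u * reach (S i) * cos (INR (S i) * step),
   rho * (1 - u) * reach i * sin (INR i * step) + rho * u * reach (S i) * sin (INR (S i) * step)).
Proof.
unfold scale, edge_point. rewrite !V_star. unfold star_vertex, scale, unit_vec; cbn [fst snd].
f_equal; ring.
Qed.

Lemma sin_basis x y A B A' B' :
  A * cos x + B * cos y = A' * cos x + B' * cos y ->
  A * sin x + B * sin y = A' * sin x + B' * sin y ->
  sin (y - x) <> 0 -> A = A' /\ B = B'.
Proof.
intros H1 H2 H3. rewrite sin_minus in H3. split; apply (Rmult_eq_reg_r (sin y * cos x - cos y * sin x)); auto.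
- transitivity ((A * cos x + B * cos y) * sin y - (A * sin x + B * sin y) * cos y); [ring|].
  rewrite H1, H2; ring.
- transitivity ((A * sin x + B * sin y) * cos x - (A * cos x + B * cos y) * sin x); [ring|].
  rewrite H1, H2; ring.
Qed.

(** The direction of a nonzero vector determines its half-open sector, hence the edge [i]. Within
    the sector the two vertex directions form a basis, in which the coefficients determine [rho] and
    [u]. *)
Lemma star_ray_inj rho rho' i j u u' :
  0 < rho -> 0 < rho' -> (i < n)%nat -> (j < n)%nat -> 0 <= u < 1 -> 0 <= u' < 1 ->
  scale rho (edge_point n star_vertex i u) = scale rho' (edge_point n star_vertex j u') ->
  rho = rho' /\ i = j /\ u = u'.
Proof.
intros Hr Hr' Hi Hj Hu Hu' H. rewrite !edge_point_star in H.
pose proof (f_equal fst H) as H1. pose proof (f_equal snd H) as H2. cbn [fst snd] in H1, H2.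
pose proof step_bound as [S1 S2]. pose proof edge_gt0 as L.
assert (Pos : forall rho u i, 0 < rho -> 0 <= u < 1 ->
   0 < rho * (1 - u) * reach i /\ 0 <= rho * u * reach (S i)).
{ intros r w q Hr1 Hw. pose proof (reach_gt0 q); pose proof (reach_gt0 (S q)).
  split; [apply Rmult_lt_0_compat; nra|apply Rmult_le_pos; nra]. }
destruct (Pos _ _ i Hr Hu) as [A1 B1]. destruct (Pos _ _ j Hr' Hu') as [A2 B2].
destruct (sector_polar i _ _ A1 B1) as (p & m & Hp & Hm & Ec & Es).
destruct (sector_polar j _ _ A2 B2) as (q & m' & Hq & Hm' & Ec' & Es').
assert (EC : m * cos (INR i * step + p) = m' * cos (INR j * step + q)) by lra.
assert (ES : m * sin (INR i * step + p) = m' * sin (INR j * step + q)) by lra.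
assert (R : forall a q', (a < n)%nat -> 0 <= q' < step -> 0 <= INR a * step + q' < 2 * PI).
{ intros a q' Ha Hq'. pose proof (pos_INR a).
  assert (INR (S a) <= INR n) as G by (apply le_INR; lia).
  rewrite S_INR, mult_INR in G. simpl (INR 2) in G. pose proof k_step. split; nra. }
pose proof (R i p Hi Hp) as Ri. pose proof (R j q Hj Hq) as Rj.
set (t := INR i * step + p) in *. set (t' := INR j * step + q) in *.
assert (Em : m = m').
{ pose proof (sin2_cos2 t) as Q. pose proof (sin2_cos2 t') as Q'. unfold Rsqr in *.
  assert (m * m = m' * m').
  { transitivity (m * m * (sin t * sin t + cos t * cos t)); [rewrite Q; ring|].
    transitivity (m' * m' * (sin t' * sin t' + cos t' * cos t')); [|rewrite Q'; ring].
    transitivity ((m * sin t) * (m * sin t) + (m * cos t) * (m * cos t)); [ring|].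
    rewrite EC, ES. ring. }
  nra. }
subst m'. apply Rmult_eq_reg_l in EC, ES; [|lra..].
assert (Et : t = t') by (apply cos_sin_inj; auto; apply Rabs_def1; lra).
assert (Eij : i = j).
{ unfold t, t' in Et. apply Nat.le_antisymm; apply Nat.lt_succ_r, INR_lt; rewrite S_INR; nra. }
subst j.
destruct (sin_basis (INR i * step) (INR (S i) * step) _ _ _ _ H1 H2) as [F1 F2].
{ rewrite S_INR. replace ((INR i + 1) * step - INR i * step) with step by ring. lra. }
pose proof (reach_gt0 i). pose proof (reach_gt0 (S i)).
apply Rmult_eq_reg_r in F1, F2; [|lra..].
(* The coefficients are [rho * (1 - u)] and [rho * u]; their sum is [rho]. *)
assert (rho = rho') as <- by lra. split; [auto|split; [auto|]].
apply Rmult_eq_reg_l in F2; lra.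
Qed.
End Star.

(** * Polar coordinates of the star *)

(** Piecewise linear interpolation of [f] at the integers up to [m], written with clamped ramps so
    that it is continuous on the whole line. *)
Fixpoint polyline (f : nat -> R) (m : nat) (t : R) : R :=
  match m with
  | O => f O
  | S m' => polyline f m' t + clamp01 (t - INR m') * (f (S m') - f m')
  end.

Lemma polyline_end f m t : INR m <= t -> polyline f m t = f m.
Proof.
induction m as [|m IH]; intros H; [reflexivity|].
cbn [polyline]. rewrite S_INR in H. rewrite IH by lra.
destruct (clamp01_cases (t - INR m)) as [[? E]|[[? E]|[? E]]]; rewrite E; [lra| |ring].
replace (t - INR m) with 1 by lra. ring.
Qed.

Lemma polylineE f m i u : (i < m)%nat -> 0 <= u <= 1 ->
  polyline f m (INR i + u) = f i + u * (f (S i) - f i).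
Proof.
intros Hi Hu. induction m as [|m IH]; [lia|]. cbn [polyline].
destruct (Nat.eq_dec i m) as [->|Hne].
- rewrite polyline_end by lra. replace (INR m + u - INR m) with u by ring.
  destruct (clamp01_cases u) as [[? E]|[[? E]|[? E]]]; rewrite E; try lra;
    [replace u with 0 by lra|replace u with 1 by lra]; ring.
- rewrite IH by lia. assert (INR (S i) <= INR m) as G by (apply le_INR; lia). rewrite S_INR in G.
  destruct (clamp01_cases (INR i + u - INR m)) as [[? E]|[[? E]|[? E]]]; rewrite E; try lra.
  replace (INR i + u - INR m) with 0 by lra. ring.
Qed.

Lemma polyline_continuous f m t : continuous (polyline f m) t.
Proof.
induction m as [|m IH]; cbn [polyline]; [apply continuous_const|].
apply (continuous_plus (V:=R_NormedModule)); [exact IH|].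
apply (continuous_mult (K:=R_AbsRing)); [|apply continuous_const].
apply (continuous_comp (fun t => t - INR m) clamp01); [|apply clamp01_continuous].
apply (continuous_minus (V:=R_NormedModule)); [apply continuous_id|apply continuous_const].
Qed.

Lemma dist_coord p q : Rabs (fst p - fst q) <= Defs.dist p q /\ Rabs (snd p - snd q) <= Defs.dist p q.
Proof.
unfold Defs.dist. rewrite <- !sqrt_Rsqr_abs. unfold Rsqr.
pose proof (pow2_ge_0 (fst p - fst q)). pose proof (pow2_ge_0 (snd p - snd q)).
split; apply sqrt_le_1_alt; lra.
Qed.

(** Compactness of [[0, T] * [0, B]] makes continuity descend along polar coordinates. *)
Lemma polar_descent (gx gy : R -> R) (T c0 : R) (F : pt -> R) (f : R -> R -> R) :
  (forall s, continuous gx s) -> (forall s, continuous gy s) -> 0 < c0 ->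
  (forall s, 0 <= s <= T -> c0 <= Rabs (gx s) + Rabs (gy s)) ->
  (forall p, exists s rho, 0 <= s <= T /\ 0 <= rho /\ p = (rho * gx s, rho * gy s)) ->
  (forall s rho, 0 <= s <= T -> 0 <= rho -> F (rho * gx s, rho * gy s) = f s rho) ->
  (forall s rho, 0 <= s <= T -> 0 <= rho -> continuity_2d_pt f s rho) ->
  forall p eps, 0 < eps -> exists delta, 0 < delta /\
    forall q, Defs.dist q p < delta -> Rabs (F q - F p) < eps.
Proof.
intros Cx Cy Hc0 Hg Hsurj HF Cf [x1 x2] eps Heps.
(* A bound on the radial coordinate of every point within distance [1] of [(x1, x2)], so that a
   compact rectangle of coordinates is enough. *)
set (B := (Rabs x1 + Rabs x2 + 2) / c0).
(* [d] is small enough at [(u, v)] if [F] varies by less than [eps] on the points with coordinates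
   near [(u, v)] that also lie near [(x1, x2)]. *)
set (P := fun (u v : R) (d : posreal) => forall s rho, 0 <= s <= T -> 0 <= rho ->
  Rabs (s - u) < d -> Rabs (rho - v) < d ->
  Rabs (rho * gx s - x1) < d -> Rabs (rho * gy s - x2) < d ->
  Rabs (F (rho * gx s, rho * gy s) - F (x1, x2)) < eps).
(* Coordinates that do not represent the given point have a neighbourhood whose image stays away
   from it, so there the condition holds vacuously. *)
assert (Far : forall (g : R -> R) u v z, (forall s, continuous g s) -> v * g u <> z ->
  exists d : posreal, forall s rho, Rabs (s - u) < d -> Rabs (rho - v) < d ->
    Rabs (rho * g s - z) < d -> False).
{ intros g u v z Cg Hne.
  assert (Hd : 0 < Rabs (v * g u - z) / 2).
  { pose proof (Rabs_pos_lt (v * g u - z)). lra. }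
  assert (C : continuity_2d_pt (fun s rho => rho * g s) u v).
  { apply continuity_2d_pt_mult; [apply continuity_2d_pt_id2|].
    apply (continuity_1d_2d_pt_comp g (fun u _ => u)); [|apply continuity_2d_pt_id1].
    apply continuity_pt_filterlim, Cg. }
  destruct (C (mkposreal _ Hd)) as [d Hd']; simpl in Hd'.
  assert (Hm : 0 < Rmin d (Rabs (v * g u - z) / 2)) by (apply Rmin_glb_lt; [apply cond_pos|auto]).
  exists (mkposreal _ Hm); simpl. intros s rho H1 H2 H3.
  pose proof (Rmin_l d (Rabs (v * g u - z) / 2)). pose proof (Rmin_r d (Rabs (v * g u - z) / 2)).
  specialize (Hd' s rho ltac:(lra) ltac:(lra)).
  pose proof (Rabs_triang (v * g u - rho * g s) (rho * g s - z)) as Tr.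
  replace (v * g u - rho * g s + (rho * g s - z)) with (v * g u - z) in Tr by ring.
  rewrite <- (Rabs_Ropp (v * g u - rho * g s)), Ropp_minus_distr in Tr. lra. }
assert (Ex : forall u v, exists d : posreal, 0 <= u <= T -> 0 <= v <= B -> P u v d).
{ intros u v. destruct (Req_dec (v * gx u) x1) as [E1|N1].
  2:{ destruct (Far gx u v x1 Cx N1) as [d Hd]. exists d. intros _ _ s rho _ _ S1 S2 S3 S4.
      exfalso; eauto. }
  destruct (Req_dec (v * gy u) x2) as [E2|N2].
  2:{ destruct (Far gy u v x2 Cy N2) as [d Hd]. exists d. intros _ _ s rho _ _ S1 S2 S3 S4.
      exfalso; eauto. }
  destruct (Rle_dec 0 u), (Rle_dec u T), (Rle_dec 0 v);
    try (exists (mkposreal 1 Rlt_0_1); intros; lra).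
  destruct (Cf u v ltac:(lra) ltac:(lra) (mkposreal eps Heps)) as [d Hd]; simpl in Hd.
  exists d. intros _ _ s rho Hs Hr S1 S2 _ _. rewrite HF by auto.
  rewrite <- E1, <- E2, HF by lra. apply Hd; auto. }
set (delta := fun u v => proj1_sig (constructive_indefinite_description _ (Ex u v))).
assert (Hdelta : forall u v, 0 <= u <= T -> 0 <= v <= B -> P u v (delta u v)).
{ intros u v. exact (proj2_sig (constructive_indefinite_description _ (Ex u v))). }
destruct (compactness_value_2d 0 T 0 B delta) as [d Hd].
exists (Rmin d 1). split; [apply Rmin_glb_lt; [apply cond_pos|lra]|].
intros q Hq. pose proof (Rmin_l d 1). pose proof (Rmin_r d 1).
destruct (Hsurj q) as (s & rho & Hs & Hr & ->).
destruct (dist_coord (rho * gx s, rho * gy s) (x1, x2)) as [D1 D2]; cbn [fst snd] in D1, D2.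
assert (HB : rho <= B).
{ unfold B. apply (Rmult_le_reg_r c0); auto. field_simplify; [|lra].
  specialize (Hg s Hs).
  pose proof (Rabs_triang (rho * gx s - x1) x1) as T1.
  pose proof (Rabs_triang (rho * gy s - x2) x2) as T2.
  replace (rho * gx s - x1 + x1) with (rho * gx s) in T1 by ring.
  replace (rho * gy s - x2 + x2) with (rho * gy s) in T2 by ring.
  rewrite Rabs_mult, (Rabs_pos_eq rho) in T1, T2 by auto. nra. }
(* Compactness provides the covering rectangle only under a double negation, which is enough to
   refute the opposite inequality. *)
apply Rnot_le_lt; intros C. apply (Hd s rho); auto.
intros (u & v & Hu & Hv & S1 & S2 & S3).
specialize (Hdelta u v Hu Hv s rho Hs Hr S1 S2). lra.
Qed.

Section StarRegion.
Variable k : nat.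
Hypothesis k_ge4 : (4 <= k)%nat.

Notation n := (2 * k)%nat.
Notation l := (sin (step k)).
Notation star := (star_vertex k).
Notation T := (INR (2 * n)).

(** The boundary of the star, parametrized with two units per edge. *)
Definition border_point (s : R) : pt := gamma n star (l / 2 * s).

Let l_pos : 0 < l := edge_gt0 k k_ge4.
Let n_pos : (0 < n)%nat. Proof. lia. Qed.
Let elenE := star_elen k k_ge4.

Lemma period_gt0 : 0 < T.
Proof. apply lt_0_INR. lia. Qed.

Lemma period_perimeter : l / 2 * T = perimeter n star.
Proof. rewrite (perimeterE _ _ l elenE), (mult_INR 2 n). simpl (INR 2). field. Qed.

Lemma borderE i u : (i < n)%nat -> 0 <= u <= 1 ->
  border_point (2 * (INR i + u)) = edge_point n star i u.
Proof.
intros Hi Hu. unfold border_point.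
replace (l / 2 * (2 * (INR i + u))) with (l * (INR i + u)) by field.
apply (gammaE n star l n_pos l_pos elenE); auto.
Qed.

Lemma border_T : border_point T = border_point 0.
Proof.
unfold border_point. rewrite period_perimeter, Rmult_0_r. apply (gamma_perimeter n star l n_pos l_pos elenE).
Qed.

Lemma border_decompose s : 0 <= s < T -> exists i u, (i < n)%nat /\ 0 <= u < 1 /\
  s = 2 * (INR i + u) /\ border_point s = edge_point n star i u.
Proof.
intros Hs. destruct (unit_decompose n (s / 2)) as (i & u & Hi & Hu & E).
{ rewrite mult_INR in Hs. simpl (INR 2) in Hs. lra. }
exists i, u. assert (E2 : s = 2 * (INR i + u)) by lra.
split; [auto|split; [auto|split; [auto|]]]. rewrite E2. apply borderE; auto; lra.
Qed.

Lemma border_decompose_le s : 0 <= s <= T -> exists i u, (i < n)%nat /\ 0 <= u < 1 /\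
  border_point s = edge_point n star i u.
Proof.
intros Hs. destruct (Req_dec s T) as [->|Hne].
- rewrite border_T. pose proof period_gt0.
  destruct (border_decompose 0) as (i & u & H1 & H2 & _ & H3); [lra|]. now exists i, u.
- destruct (border_decompose s) as (i & u & H1 & H2 & _ & H3); [lra|]. now exists i, u.
Qed.

(** The coordinates of [border_point] on one closed period, without the reduction modulo the
    perimeter and the search for the edge, so that their continuity is immediate. *)
Definition border_x (s : R) : R := polyline (fun i => fst (star i)) n (s / 2).
Definition border_y (s : R) : R := polyline (fun i => snd (star i)) n (s / 2).

Lemma border_xy s : 0 <= s <= T -> border_point s = (border_x s, border_y s).
Proof.
intros Hs. unfold border_x, border_y.
destruct (Req_dec s T) as [->|Hne].
- assert (INR n <= T / 2) by (rewrite (mult_INR 2 n); simpl (INR 2); lra).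
  rewrite !polyline_end by auto. rewrite border_T.
  replace 0 with (2 * (INR 0 + 0)) by (simpl; ring). rewrite borderE by (auto; lra).
  unfold edge_point. rewrite !(V_star k k_ge4).
  replace (star n) with (star 0) by (rewrite <- (star_period k k_ge4 0 1); f_equal; lia).
  f_equal; ring.
- destruct (border_decompose s) as (i & u & H1 & H2 & -> & H3); [lra|].
  rewrite H3. unfold edge_point. rewrite !(V_star k k_ge4).
  replace (2 * (INR i + u) / 2) with (INR i + u) by field.
  now rewrite !polylineE by (auto; lra).
Qed.

Lemma half_continuous (f : R -> R) s : (forall t, continuous f t) -> continuous (fun t => f (t / 2)) s.
Proof.
intros Hf. apply (continuous_comp (fun t => t / 2) f); [|apply Hf].
apply (continuous_mult (K:=R_AbsRing)); [apply continuous_id|apply continuous_const].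
Qed.

Lemma reach_prod i : reach k i * reach k (S i) = sin (step k / 2) * sin (3 * step k / 2).
Proof.
unfold reach. rewrite Nat.even_succ, <- Nat.negb_even. destruct (Nat.even i); cbn [negb]; ring.
Qed.

(** Along an edge the cross product of the position with the edge vector is constant, twice the area
    of the triangle spanned with the centre. As the components of the edge vector are at most [l],
    the position cannot be short. *)
Lemma border_lower s : 0 <= s <= T ->
  sin (step k / 2) * sin (3 * step k / 2) <= Rabs (border_x s) + Rabs (border_y s).
Proof.
intros Hs. destruct (border_decompose_le s Hs) as (i & u & Hi & Hu & E).
rewrite (border_xy s Hs) in E.
replace (border_x s) with (fst (edge_point n star i u)) by now rewrite <- E.
replace (border_y s) with (snd (edge_point n star i u)) by now rewrite <- E.
clear E. unfold edge_point; cbn [fst snd]. rewrite !(V_star k k_ge4).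
set (dx := fst (star (S i)) - fst (star i)). set (dy := snd (star (S i)) - snd (star i)).
assert (D : Rabs dx <= l /\ Rabs dy <= l).
{ pose proof (elenE i) as En. unfold elen in En. rewrite !(V_star k k_ge4) in En.
  destruct (dist_coord (star i) (star (S i))) as [D1 D2]. rewrite En in D1, D2.
  unfold dx, dy. now rewrite <- (Rabs_Ropp (fst _ - _)), <- (Rabs_Ropp (snd _ - _)), !Ropp_minus_distr. }
set (px := fst (star i) + u * dx). set (py := snd (star i) + u * dy).
assert (C : px * dy - py * dx = reach k i * reach k (S i) * l).
{ transitivity (cross (star i) (star (S i))).
  - unfold px, py, dx, dy, cross. ring.
  - unfold star_vertex. rewrite cross_scale, S_INR.
    replace ((INR i + 1) * step k - INR i * step k) with (step k) by ring. ring. }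
rewrite reach_prod in C.
pose proof (Rle_abs (px * dy)). pose proof (Rle_abs (- (py * dx))).
rewrite Rabs_Ropp, !Rabs_mult in *.
pose proof (Rabs_pos px). pose proof (Rabs_pos py).
apply (Rmult_le_reg_r l); auto. nra.
Qed.

Lemma border_lower_gt0 : 0 < sin (step k / 2) * sin (3 * step k / 2).
Proof. pose proof (step_bound k k_ge4). apply Rmult_lt_0_compat; apply sin_gt_0; lra. Qed.

Lemma border_neq0 s : 0 <= s <= T -> border_point s <> (0, 0).
Proof.
intros Hs C. rewrite border_xy in C by auto. injection C as C1 C2.
pose proof (border_lower s Hs) as L. rewrite C1, C2, Rabs_R0 in L.
pose proof border_lower_gt0. lra.
Qed.

Lemma norm2_scale_pt c p : norm2 (scale c p) = Rabs c * norm2 p.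
Proof.
unfold norm2, scale; cbn [fst snd]. rewrite <- sqrt_Rsqr_abs, <- sqrt_mult_alt.
- f_equal. unfold Rsqr. ring.
- unfold Rsqr. nra.
Qed.

Lemma border_upper s : 0 <= s <= T -> norm2 (border_point s) <= norm2 (star 1).
Proof.
intros Hs. destruct (border_decompose_le s Hs) as (i & u & Hi & Hu & ->).
pose proof (step_bound k k_ge4) as [S1 S2].
set (r := sin (3 * step k / 2)).
assert (Hr0 : 0 < r) by (apply sin_gt_0; lra).
assert (Hr : forall j, reach k j <= r).
{ intros j. unfold reach, r. destruct Nat.even; [|lra]. left. apply sin_increasing_1; lra. }
assert (Hn : norm2 (star 1) = r).
{ unfold star_vertex. rewrite norm2_scale. unfold reach; cbn [Nat.even]. apply Rabs_pos_eq; fold r; lra. }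
rewrite Hn.
replace (edge_point n star i u) with (scale 1 (edge_point n star i u))
  by (unfold scale; rewrite !Rmult_1_l; symmetry; apply surjective_pairing).
rewrite (edge_point_star k k_ge4), !Rmult_1_l.
set (A := (1 - u) * reach k i). set (B := u * reach k (S i)).
pose proof (reach_gt0 k k_ge4 i). pose proof (reach_gt0 k k_ge4 (S i)).
pose proof (Hr i). pose proof (Hr (S i)).
assert (HA : 0 <= A) by (unfold A; nra). assert (HB : 0 <= B) by (unfold B; nra).
assert (HAB : A + B <= r) by (unfold A, B; nra).
rewrite <- (sqrt_Rsqr r) by lra. unfold norm2. apply sqrt_le_1_alt; cbn [fst snd].
set (x := INR i * step k). set (y := INR (S i) * step k).
pose proof (sin2_cos2 x) as Qx. pose proof (sin2_cos2 y) as Qy.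
pose proof (COS_bound (x - y)) as [_ Cxy]. rewrite cos_minus in Cxy. unfold Rsqr in *.
apply Rle_trans with ((A + B) * (A + B)); [|nra].
apply Rle_trans with (A * A * (sin x * sin x + cos x * cos x) + B * B * (sin y * sin y + cos y * cos y)
   + 2 * (A * B) * (cos x * cos y + sin x * sin y)); [right; ring|].
rewrite Qx, Qy. assert (0 <= A * B) by nra. nra.
Qed.

Lemma border_ray_inj s s' rho rho' :
  0 <= s <= T -> 0 <= s' <= T -> 0 <= rho -> 0 <= rho' ->
  scale rho (border_point s) = scale rho' (border_point s') ->
  rho = rho' /\ (rho = 0 \/ s = s' \/ (s = 0 /\ s' = T) \/ (s = T /\ s' = 0)).
Proof.
intros Hs Hs' Hr Hr' H.
assert (Z : forall c p, p <> (0, 0) -> scale c p = (0, 0) -> c = 0).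
{ intros c [p1 p2] Hp E. unfold scale in E; cbn [fst snd] in E. injection E as E1 E2.
  destruct (Req_dec c 0); auto. exfalso; apply Hp. f_equal; nra. }
assert (S0 : forall p, scale 0 p = (0, 0)) by (intros; unfold scale; f_equal; ring).
destruct (Req_dec rho 0) as [->|N0].
{ rewrite S0 in H. symmetry in H. apply Z in H; [auto|now apply border_neq0]. }
destruct (Req_dec rho' 0) as [->|N0'].
{ rewrite S0 in H. apply Z in H; [auto|now apply border_neq0]. }
pose proof period_gt0 as HT.
assert (W : forall s, 0 <= s <= T -> exists i u, (i < n)%nat /\ 0 <= u < 1 /\
   border_point s = edge_point n star i u /\
   (s = 2 * (INR i + u) \/ (s = T /\ 2 * (INR i + u) = 0))).
{ intros z Hz. destruct (Req_dec z T) as [Ez|Hne].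
  - subst z. destruct (border_decompose 0) as (i & u & H1 & H2 & H4 & H3); [lra|].
    exists i, u. rewrite border_T. symmetry in H4. auto 6.
  - destruct (border_decompose z) as (i & u & H1 & H2 & H4 & H3); [lra|]. exists i, u. auto. }
destruct (W s' Hs') as (j & w & Hj & Hw & E' & C').
destruct (W s Hs) as (i & u & Hi & Hu & E & C).
rewrite E, E' in H.
destruct (star_ray_inj k k_ge4 rho rho' i j u w) as (<- & <- & <-); auto; try lra.
Qed.

Lemma border_ray_surj p : exists s rho, 0 <= s <= T /\ 0 <= rho /\ p = scale rho (border_point s).
Proof.
destruct p as [x y].
pose proof (step_bound k k_ge4) as [S1 S2]. pose proof (k_step k k_ge4) as KS.
set (m := sqrt (x ^ 2 + y ^ 2)).
destruct (Req_dec (x ^ 2 + y ^ 2) 0) as [Z|Z].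
{ exists 0, 0. pose proof period_gt0. split; [lra|split; [lra|]]. unfold scale. f_equal; nra. }
assert (Hm : 0 < m) by (apply sqrt_lt_R0; nra).
assert (Hm2 : m ^ 2 = x ^ 2 + y ^ 2) by (apply pow2_sqrt; nra).
destruct (polar_unit (x / m) (y / m)) as (th & Hth & Hc & Hs).
{ replace ((x / m) ^ 2 + (y / m) ^ 2) with ((x ^ 2 + y ^ 2) / m ^ 2) by (field; lra).
  rewrite Hm2. field. nra. }
destruct (unit_decompose n (th / step k)) as (i & w & Hi & Hw & E).
{ rewrite mult_INR. simpl (INR 2).
  split; [apply Rmult_le_pos; [lra|left; now apply Rinv_0_lt_compat]|].
  apply (Rmult_lt_reg_r (step k)); auto. field_simplify; lra. }
set (d := step k) in *. set (phi := w * d).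
assert (Eth : th = INR i * d + phi) by (unfold phi; rewrite <- Rmult_plus_distr_r, <- E; field; lra).
assert (Hphi : 0 <= phi < d) by (unfold phi; nra).
assert (P1 : 0 < sin (d - phi)) by (apply sin_gt_0; lra).
assert (P2 : 0 <= sin phi) by (apply sin_ge_0; lra).
pose proof (reach_gt0 k k_ge4 i) as R1. pose proof (reach_gt0 k k_ge4 (S i)) as R2.
(* By the law of sines these are the coefficients of [(x, y)] along the two vertices bounding its
   sector. Their sum is the radial coordinate and [B / (A + B)] the position along the edge. *)
set (A := m * sin (d - phi) / (reach k i * l)). set (B := m * sin phi / (reach k (S i) * l)).
assert (HA : 0 < A).
{ apply Rdiv_lt_0_compat; apply Rmult_lt_0_compat; auto. }
assert (HB : 0 <= B).
{ apply Rmult_le_pos; [nra|]. left. apply Rinv_0_lt_compat, Rmult_lt_0_compat; auto. }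
exists (2 * (INR i + B / (A + B))), (A + B).
assert (HBA : 0 <= B / (A + B) <= 1).
{ split; [apply Rmult_le_pos; [auto|left; apply Rinv_0_lt_compat; lra]|].
  apply (Rmult_le_reg_r (A + B)); [lra|]. field_simplify; lra. }
assert (G : INR i + 1 <= INR n) by (rewrite <- S_INR; apply le_INR; lia).
split; [pose proof (pos_INR i); rewrite (mult_INR 2 n); simpl (INR 2); lra|split; [lra|]].
rewrite borderE, (edge_point_star k k_ge4) by auto.
replace ((A + B) * (1 - B / (A + B)) * reach k i) with (A * reach k i) by (field; lra).
replace ((A + B) * (B / (A + B)) * reach k (S i)) with (B * reach k (S i)) by (field; lra).
assert (Hl : 0 < l) by exact l_pos.
replace (A * reach k i) with (m * sin (d - phi) / l) by (unfold A; field; split; lra).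
replace (B * reach k (S i)) with (m * sin phi / l) by (unfold B; field; split; lra).
replace (INR (S i) * step k) with (INR i * step k + step k) by (rewrite S_INR; ring).
assert (Ex : x = m * cos th) by (rewrite Hc; field; lra).
assert (Ey : y = m * sin th) by (rewrite Hs; field; lra).
rewrite Ex, Ey, Eth. unfold d. rewrite !cos_plus, !sin_plus, !sin_minus.
f_equal; field; lra.
Qed.
End StarRegion.

(** * Gluing the star along a tree *)

Section StarGluing.
Variable k : nat.
Hypothesis k_ge4 : (4 <= k)%nat.

Notation n := (2 * k)%nat.
Notation l := (sin (step k)).
Notation star := (star_vertex k).
Notation T := (INR (2 * n)).
Notation border := (border_point k).

Let l_pos : 0 < l := edge_gt0 k k_ge4.
Let n_pos : (0 < n)%nat. Proof. lia. Qed.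
Let elenE := star_elen k k_ge4.
Let T_pos : 0 < T := period_gt0 k k_ge4.

Lemma border_same s : scale 1 (border s) = border s.
Proof. unfold scale. rewrite !Rmult_1_l. symmetry; apply surjective_pairing. Qed.

(** A continuous function of the polar coordinates descends to the plane when it is constant at the
    centre and matches along the seam. It is applied to the radial coordinate, which detects the
    region, and to the three coordinates of the sphere map. *)
Lemma star_lift (f : R -> R -> R) :
  (forall s s', f s 0 = f s' 0) -> (forall rho, 0 <= rho -> f 0 rho = f T rho) ->
  (forall s rho, 0 <= s <= T -> 0 <= rho -> continuity_2d_pt f s rho) ->
  exists F : pt -> R,
    (forall s rho, 0 <= s <= T -> 0 <= rho -> F (scale rho (border s)) = f s rho) /\
    (forall p eps, 0 < eps -> exists delta, 0 < delta /\
       forall q, Defs.dist q p < delta -> Rabs (F q - F p) < eps).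
Proof.
intros F0 FT Fc.
assert (Ex : forall p, exists c : R * R,
   0 <= fst c <= T /\ 0 <= snd c /\ p = scale (snd c) (border (fst c))).
{ intros p. destruct (border_ray_surj k k_ge4 p) as (s & rho & H). now exists (s, rho). }
set (coord := fun p => proj1_sig (constructive_indefinite_description _ (Ex p))).
assert (Hc : forall p, 0 <= fst (coord p) <= T /\ 0 <= snd (coord p) /\
   p = scale (snd (coord p)) (border (fst (coord p)))).
{ intros p. exact (proj2_sig (constructive_indefinite_description _ (Ex p))). }
exists (fun p => f (fst (coord p)) (snd (coord p))).
assert (V : forall s rho, 0 <= s <= T -> 0 <= rho ->
  f (fst (coord (scale rho (border s)))) (snd (coord (scale rho (border s)))) = f s rho).
{ intros s rho Hs Hr. destruct (Hc (scale rho (border s))) as (C1 & C2 & C3).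
  apply (border_ray_inj k k_ge4) in C3; auto.
  destruct C3 as [E C]. rewrite <- E.
  destruct C as [->|[<-|[[-> ->]|[-> ->]]]]; auto. symmetry; auto. }
split; [exact V|].
apply (polar_descent (border_x k) (border_y k) T (sin (step k / 2) * sin (3 * step k / 2)) _ f).
- intros s. apply half_continuous. intros; apply polyline_continuous.
- intros s. apply half_continuous. intros; apply polyline_continuous.
- apply (border_lower_gt0 k k_ge4).
- apply (border_lower k k_ge4).
- intros p. destruct (border_ray_surj k k_ge4 p) as (s & rho & Hs & Hr & ->).
  exists s, rho. rewrite (border_xy k k_ge4) by auto. auto.
- intros s rho Hs Hr. rewrite <- (V s rho) by auto. now rewrite (border_xy k k_ge4 s) by auto.
- exact Fc.
Qed.

Lemma on_boundary_border p : on_boundary n star p <-> exists s, 0 <= s < T /\ p = border s.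
Proof.
split.
- intros [s <-]. exists (rmod n star s / (l / 2)).
  pose proof (rmod_range n star l n_pos l_pos elenE s) as R.
  rewrite <- (period_perimeter k k_ge4) in R.
  split; [split|].
  + apply Rmult_le_pos; [lra|]. left; apply Rinv_0_lt_compat; lra.
  + apply (Rmult_lt_reg_r (l / 2)); [lra|]. field_simplify; lra.
  + unfold border_point. replace (l / 2 * (rmod n star s / (l / 2))) with (rmod n star s) by (field; lra).
    apply (gamma_rmod n star l n_pos l_pos elenE).
- intros (s & _ & ->). now exists (l / 2 * s).
Qed.

Lemma border_vertex i : (i < n)%nat -> border (INR (2 * i)) = V n star i.
Proof.
intros Hi. unfold border_point. rewrite mult_INR.
replace (l / 2 * (INR 2 * INR i)) with (l * INR i) by (simpl; field).
apply (gamma_vertex n star l n_pos l_pos elenE i Hi).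
Qed.

Lemma vertex_time i : (i < n)%nat -> 0 <= INR (2 * i) < T.
Proof. intros Hi. split; [apply pos_INR|apply lt_INR; lia]. Qed.

(** From a point with [rho > 1] the outward ray escapes without meeting the boundary. From a point
    with [rho <= 1], the radial coordinate is continuous along any path and must pass through [1] on
    the way out, which happens exactly on the boundary. *)
Lemma star_region p : region n star p <->
  exists s rho, 0 <= s <= T /\ 0 <= rho <= 1 /\ p = scale rho (border s).
Proof.
split.
- intros Hp. destruct (border_ray_surj k k_ge4 p) as (s & rho & Hs & Hr & E).
  exists s, rho. split; [auto|split; [|auto]]. split; [auto|]. apply Rnot_lt_le; intros G.
  assert (Hn : 0 < norm2 p).
  { subst p. rewrite norm2_scale_pt, Rabs_pos_eq by auto.
    apply Rmult_lt_0_compat; [lra|]. pose proof (border_neq0 k k_ge4 s Hs) as N0.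
    unfold norm2. apply sqrt_lt_R0.
    destruct (border s) as [x y]; cbn [fst snd].
    destruct (Req_dec x 0), (Req_dec y 0); subst; try (exfalso; apply N0; reflexivity); nra. }
  (* Stretching [p] by [1 + K] adds the norm of a tip to its own norm, which takes it beyond all
     vertices. *)
  set (K := norm2 (star 1) / norm2 p).
  assert (HK : 0 <= K).
  { apply Rmult_le_pos; [apply sqrt_pos|left; now apply Rinv_0_lt_compat]. }
  destruct (Hp (fun t => scale (1 + t * K) p)) as (t & Ht & B).
  + intros t _ eps Heps. exists (eps / (K * norm2 p + 1)).
    assert (Q : 0 < K * norm2 p + 1) by nra.
    split; [now apply Rdiv_lt_0_compat|]. intros t' _ Htt.
    change (norm2 (vsub (scale (1 + t' * K) p) (scale (1 + t * K) p)) < eps).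
    replace (vsub (scale (1 + t' * K) p) (scale (1 + t * K) p)) with (scale ((t' - t) * K) p)
      by (unfold vsub, scale; cbn [fst snd]; f_equal; ring).
    rewrite norm2_scale_pt, Rabs_mult, (Rabs_pos_eq K) by auto.
    apply (Rmult_lt_compat_r (K * norm2 p + 1)) in Htt; auto.
    replace (eps / (K * norm2 p + 1) * (K * norm2 p + 1)) with eps in Htt by (field; lra).
    pose proof (Rabs_pos (t' - t)). nra.
  + unfold scale. destruct p; cbn [fst snd]. f_equal; ring.
  + intros i Hi. rewrite norm2_scale_pt, Rabs_pos_eq by nra.
    replace ((1 + 1 * K) * norm2 p) with (norm2 p + norm2 (star 1)) by (unfold K; field; lra).
    pose proof (vertex_time i Hi).
    pose proof (border_upper k k_ge4 (INR (2 * i))) as U. rewrite border_vertex in U by auto.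
    specialize (U ltac:(lra)). lra.
  + apply on_boundary_border in B as (s' & Hs' & B).
    rewrite <- (border_same s') in B by lra. subst p.
    assert (B' : scale ((1 + t * K) * rho) (border s) = scale 1 (border s')).
    { rewrite <- B. unfold scale; cbn [fst snd]; f_equal; ring. }
    assert (0 <= t * K) by nra.
    apply (border_ray_inj k k_ge4) in B'; try lra; nra.
- intros (s & rho & Hs & Hr & E) c Hc H0 H1.
  destruct (star_lift (fun _ rho => rho)) as (g & Hg & Cg); auto.
  { intros; apply continuity_2d_pt_id2. }
  assert (Bd : forall q, g q = 1 -> on_boundary n star q).
  { intros q Hq. destruct (border_ray_surj k k_ge4 q) as (s' & rho' & Hs' & Hr' & ->).
    rewrite Hg in Hq by auto. subst rho'. rewrite border_same by auto.
    eexists; reflexivity. }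
  assert (G1 : 1 < g (c 1)).
  { destruct (border_ray_surj k k_ge4 (c 1)) as (s' & rho' & Hs' & Hr' & E').
    rewrite E', Hg by auto. apply Rnot_le_lt; intros L.
    specialize (H1 1%nat ltac:(lia)). rewrite (V_star k k_ge4), E', norm2_scale_pt, Rabs_pos_eq in H1 by auto.
    pose proof (border_upper k k_ge4 s' Hs'). assert (0 <= norm2 (border s')) by apply sqrt_pos. nra. }
  assert (G0 : g (c 0) <= 1) by (rewrite H0, E, Hg by lra; lra).
  destruct (Req_dec (g (c 0)) 1) as [Z|Z].
  { exists 0. split; [lra|auto]. }
  (* The path is controlled on [[0, 1]] only; clamping the time extends it to a continuous path on
     the whole line. *)
  destruct (IVT (fun t => g (c (clamp01 t)) - 1) 0 1) as (t & Ht & Et).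
  + intros t eps Heps.
    destruct (Cg (c (clamp01 t)) eps Heps) as (d1 & Hd1 & D1).
    assert (R01 : forall x, 0 <= clamp01 x <= 1).
    { intros x. destruct (clamp01_cases x) as [[? ->]|[[? ->]|[? ->]]]; lra. }
    destruct (Hc (clamp01 t) (R01 t) d1 Hd1) as (d2 & Hd2 & D2).
    exists d2. split; [exact Hd2|]. intros x [_ Hx]. simpl in *. unfold Rdist in *.
    replace (g (c (clamp01 x)) - 1 - (g (c (clamp01 t)) - 1))
      with (g (c (clamp01 x)) - g (c (clamp01 t))) by ring.
    apply D1, D2; [apply R01|]. eapply Rle_lt_trans; [|exact Hx].
    unfold Rabs. destruct (clamp01_cases x) as [[? ->]|[[? ->]|[? ->]]],
      (clamp01_cases t) as [[? ->]|[[? ->]|[? ->]]]; repeat destruct Rcase_abs; lra.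
  + lra.
  + replace (clamp01 0) with 0 by clamp. lra.
  + replace (clamp01 1) with 1 by clamp. lra.
  + exists t. split; [auto|]. apply Bd. replace (clamp01 t) with t in Et by clamp. lra.
Qed.

(** Contour step [i] is the half edge starting at arc length [l / 2 * INR i]. The sides of a tree
    edge run in opposite directions, hence the orientation-reversing flag. *)
Definition tree_gluing (t : tree) : gluing :=
  map (fun p => (l / 2 * INR (fst p), l / 2 * INR (snd p), l / 2, true)) (edge_pairs 0 t).

Section OneTree.
Variable t : tree.
Hypothesis size_t : size t = (2 * n)%nat.

Notation G := (tree_gluing t).
Notation tau := (contour t).

Lemma seam_same_point : same_point tau 0 T.
Proof.
split; [rewrite !contour_out; auto; rewrite size_t; lra|].
intros x _. rewrite contour_out by lra. apply contour_ge0.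
Qed.

Lemma border_eq_same_point s s' : 0 <= s <= T -> 0 <= s' <= T -> border s = border s' ->
  same_point tau s s'.
Proof.
intros Hs Hs' E. rewrite <- (border_same s), <- (border_same s') in E by auto.
apply (border_ray_inj k k_ge4) in E; auto; try lra.
destruct E as [_ [E|[<-|[[-> ->]|[-> ->]]]]].
- lra.
- apply same_point_refl.
- apply seam_same_point.
- apply same_point_sym, seam_same_point.
Qed.

Lemma pair_range i j : In (i, j) (edge_pairs 0 t) ->
  0 <= INR i /\ INR i + 1 <= T /\ 0 <= INR j /\ INR j + 1 <= T.
Proof.
intros H. apply edge_pairs_range in H as (H1 & H2 & H3). rewrite size_t in H3.
pose proof (pos_INR i); pose proof (pos_INR j). rewrite <- !S_INR.
repeat split; auto; apply le_INR; lia.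
Qed.

(** [glued] is a relation on the whole plane and reflexive also off the boundary, hence the first
    alternative. *)
Lemma glued_cases x y : glued n star G x y -> x = y \/
  exists s s', 0 <= s <= T /\ 0 <= s' <= T /\ x = border s /\ y = border s' /\ same_point tau s s'.
Proof.
unfold glued. induction 1 as [x y H|x|x y H IH|x y z H1 IH1 H2 IH2].
- destruct H as (g & Hg & u & Hu & -> & ->). right.
  apply in_map_iff in Hg as ([i j] & <- & Hij).
  unfold gp_a, gp_b, gp_l, gp_image, gp_rev in *; cbn [fst snd] in *.
  pose proof (pair_range i j Hij).
  assert (Hu1 : 0 <= u / (l / 2) <= 1).
  { split; [apply Rmult_le_pos; [lra|left; apply Rinv_0_lt_compat; lra]|].
    apply (Rmult_le_reg_r (l / 2)); [lra|]. field_simplify; lra. }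
  exists (INR i + u / (l / 2)), (INR j + 1 - u / (l / 2)).
  split; [lra|split; [lra|]]. unfold border_point. split; [f_equal; field; lra|].
  split; [unfold gp_b, gp_l; cbn [fst snd]; f_equal; field; lra|].
  pose proof (edge_pairs_same_point t 0 i j _ Hij Hu1) as S.
  simpl (INR 0) in S. now rewrite !Rminus_0_r in S.
- now left.
- destruct IH as [->|(s & s' & H1 & H2 & -> & -> & H3)]; [now left|].
  right. exists s', s. auto 6 using same_point_sym.
- destruct IH1 as [->|(s & s' & A1 & A2 & -> & -> & A3)]; auto.
  destruct IH2 as [<-|(r & r' & B1 & B2 & B4 & -> & B3)].
  { right. exists s, s'. auto 6. }
  right. exists s, r'. repeat (split; [now auto|]).
  apply same_point_trans with s'; auto. apply same_point_trans with r; auto.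
  now apply border_eq_same_point.
Qed.

Lemma same_point_glued s s' : 0 <= s <= T -> 0 <= s' <= T -> same_point tau s s' ->
  glued n star G (border s) (border s').
Proof.
assert (W : forall s s', 0 <= s -> s <= s' -> s' <= T -> same_point tau s s' ->
   glued n star G (border s) (border s')).
{ clear s s'. intros s s' H1 H2 H3 H.
  replace s with (INR 0 + s) by (simpl; ring). replace s' with (INR 0 + s') by (simpl; ring).
  apply (same_point_generated (fun x y => glued n star G (border x) (border y)) t 0); auto.
  - intros x. apply rst_refl.
  - intros x y z. apply rst_trans.
  - intros i j u Hij Hu. apply rst_step.
    exists (l / 2 * INR i, l / 2 * INR j, l / 2, true). split.
    { apply in_map_iff. now exists (i, j). }
    exists (l / 2 * u). unfold gp_a, gp_image, gp_rev, gp_b, gp_l; cbn [fst snd].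
    split; [nra|]. unfold border_point. split; f_equal; ring.
  - now rewrite size_t. }
intros Hs Hs' H. destruct (Rle_dec s s'); [apply W; lra || auto|].
apply rst_sym, W; try lra. now apply same_point_sym.
Qed.

Lemma glued_border s q : 0 <= s <= T -> glued n star G (border s) q ->
  exists s', 0 <= s' <= T /\ q = border s' /\ same_point tau s s'.
Proof.
intros Hs H. apply glued_cases in H as [<-|(r & r' & H1 & H2 & H3 & H4 & H5)].
- exists s. auto using same_point_refl.
- exists r'. split; [auto|split; [auto|]]. apply same_point_trans with r; auto.
  now apply border_eq_same_point.
Qed.

Lemma tree_is_gluing : is_gluing n star G.
Proof.
split; [|split].
- intros g Hg. apply in_map_iff in Hg as (p & <- & _). unfold gp_l; cbn [fst snd]. lra.
- assert (A : arcs G = map (fun e => (l / 2 * INR e, l / 2)) (endpoints (edge_pairs 0 t))).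
  { unfold arcs, tree_gluing, endpoints. induction (edge_pairs 0 t) as [|p L IH]; [reflexivity|].
    cbn [map flat_map app]. rewrite IH. reflexivity. }
  assert (P := endpoints_perm t 0).
  assert (Nd : NoDup (endpoints (edge_pairs 0 t))).
  { apply Permutation_NoDup with (seq 0 (size t)); [now symmetry|apply seq_NoDup]. }
  rewrite A, length_map. intros i j Hi Hj Hij u w.
  rewrite (nth_indep _ (0, 0) (l / 2 * INR 0, l / 2)) by now rewrite length_map.
  rewrite (nth_indep _ (0, 0) (l / 2 * INR 0, l / 2)) by now rewrite length_map.
  rewrite !(map_nth (fun e => (l / 2 * INR e, l / 2))). cbn [fst snd].
  assert (Rg : forall m, (m < length (endpoints (edge_pairs 0 t)))%nat ->
     INR (nth m (endpoints (edge_pairs 0 t)) 0%nat) + 1 <= T).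
  { intros m Hm. rewrite <- S_INR. apply le_INR.
    assert (In (nth m (endpoints (edge_pairs 0 t)) 0%nat) (seq 0 (size t))) as I.
    { eapply Permutation_in; [exact P|]. now apply nth_In. }
    apply in_seq in I. lia. }
  pose proof (Rg i Hi) as Ri. pose proof (Rg j Hj) as Rj.
  set (e := nth i _ _) in *. set (e' := nth j _ _) in *.
  assert (Ne : e <> e').
  { intros C. apply Hij. eapply NoDup_nth; eauto. }
  intros Hu Hw C.
  assert (Fr : forall z, 0 < z < l / 2 -> 0 < z / (l / 2) < 1).
  { intros z Hz. split; [apply Rdiv_lt_0_compat; lra|].
    apply (Rmult_lt_reg_r (l / 2)); [lra|]. field_simplify; lra. }
  pose proof (Fr u Hu). pose proof (Fr w Hw). pose proof (pos_INR e). pose proof (pos_INR e').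
  assert (C' : scale 1 (border (INR e + u / (l / 2))) = scale 1 (border (INR e' + w / (l / 2)))).
  { rewrite !border_same by lra. unfold border_point.
    replace (l / 2 * (INR e + u / (l / 2))) with (l / 2 * INR e + u) by (field; lra).
    replace (l / 2 * (INR e' + w / (l / 2))) with (l / 2 * INR e' + w) by (field; lra). exact C. }
  apply (border_ray_inj k k_ge4) in C'; try lra.
  destruct C' as [_ [C'|[C'|[C'|C']]]]; try lra.
  apply Ne. apply Nat.le_antisymm; apply Nat.lt_succ_r, INR_lt; rewrite S_INR; lra.
- assert (S : forall L : list (nat * nat), sum_len (map (fun p =>
     (l / 2 * INR (fst p), l / 2 * INR (snd p), l / 2, true)) L) =
     l / 2 * INR (length (endpoints L))).
  { induction L as [|p L IH]; [simpl; ring|].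
    cbn [map sum_len]. rewrite IH. unfold gp_l; cbn [fst snd].
    unfold endpoints; cbn [flat_map app length]. rewrite !S_INR. field. }
  unfold tree_gluing. rewrite S, (Permutation_length (endpoints_perm t 0)), length_seq, size_t.
  apply (period_perimeter k k_ge4).
Qed.

Lemma tree_sphere_result : sphere_result n star G.
Proof.
(* Any level above the contour would do; the contour is bounded by the size [T] of the tree. *)
set (M := T + 1).
assert (Mt : forall s, tau s < M).
{ intros s. pose proof (contour_le t s) as H. rewrite size_t in H. unfold M. lra. }
assert (t0 : tau 0 = 0) by (apply contour_out; lra).
assert (tT : tau T = 0) by (apply contour_out; rewrite size_t; lra).
pose proof (contour_continuous t) as Ct. pose proof (contour_ge0 t) as Pt.
(* Outside the star the map is continued as a constant along rays, since lifting is done on the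
   whole plane. *)
set (S := fun s rho => sphere_map tau M T s (Rmin rho 1)).
assert (Rm : forall rho, 0 <= rho -> 0 <= Rmin rho 1 <= 1).
{ intros rho H. unfold Rmin; destruct Rle_dec; lra. }
assert (R0 : Rmin 0 1 = 0) by (apply Rmin_left; lra).
assert (S0 : forall s s', S s 0 = S s' 0).
{ intros s s'. unfold S. rewrite R0. now apply sphere_map_pole. }
assert (ST : forall rho, 0 <= rho -> S 0 rho = S T rho).
{ intros rho H. apply sphere_map_seam; auto. }
assert (Cm : forall f s rho, 0 <= rho ->
  (forall s rho, 0 <= rho <= 1 -> continuity_2d_pt f s rho) ->
  continuity_2d_pt (fun u v => f u (Rmin v 1)) s rho).
{ intros f s rho Hr Cf eps. destruct (Cf s (Rmin rho 1) (Rm rho Hr) eps) as [d Hd].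
  exists d. intros u v Hu Hv. apply Hd; auto. eapply Rle_lt_trans; [|exact Hv].
  unfold Rmin, Rabs. repeat destruct Rle_dec; repeat destruct Rcase_abs; lra. }
destruct (star_lift (fun s rho => fst (fst (S s rho)))) as (h1 & H1 & C1).
{ intros s s'; now rewrite (S0 s s'). } { intros; now rewrite ST. }
{ intros s rho _ Hr. apply (Cm (fun s rho => fst (fst (sphere_map tau M T s rho)))); auto.
  intros; apply wheel_continuous; auto; [intros; apply continuity_cos|].
  intros x. apply Rabs_le. apply COS_bound. }
destruct (star_lift (fun s rho => snd (fst (S s rho)))) as (h2 & H2 & C2).
{ intros s s'; now rewrite (S0 s s'). } { intros; now rewrite ST. }
{ intros s rho _ Hr. apply (Cm (fun s rho => snd (fst (sphere_map tau M T s rho)))); auto.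
  intros; apply wheel_continuous; auto; [intros; apply continuity_sin|].
  intros x. apply Rabs_le. apply SIN_bound. }
destruct (star_lift (fun s rho => snd (S s rho))) as (h3 & H3 & C3).
{ intros s s'; now rewrite (S0 s s'). } { intros; now rewrite ST. }
{ intros s rho _ Hr. apply (Cm (fun s rho => snd (sphere_map tau M T s rho))); auto.
  intros; apply altitude_continuous; auto. }
set (h := fun p => (h1 p, h2 p, h3 p)).
assert (Hh : forall s rho, 0 <= s <= T -> 0 <= rho <= 1 ->
   h (scale rho (border s)) = sphere_map tau M T s rho).
{ intros s rho Hs Hr. unfold h. rewrite H1, H2, H3 by lra. unfold S.
  rewrite Rmin_left by lra. now rewrite <- !surjective_pairing. }
exists h. repeat split.
- intros x _ eps Heps.
  (* With all three coordinates within [eps / 2] the distance squared is below [3 / 4] of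
     [eps ^ 2]. *)
  destruct (C1 x (eps / 2)) as (d1 & P1 & D1); [lra|].
  destruct (C2 x (eps / 2)) as (d2 & P2 & D2); [lra|].
  destruct (C3 x (eps / 2)) as (d3 & P3 & D3); [lra|].
  exists (Rmin d1 (Rmin d2 d3)). split; [repeat apply Rmin_glb_lt; auto|].
  intros y _ Hy. pose proof (Rmin_l d1 (Rmin d2 d3)). pose proof (Rmin_r d1 (Rmin d2 d3)).
  pose proof (Rmin_l d2 d3). pose proof (Rmin_r d2 d3).
  specialize (D1 y ltac:(lra)). specialize (D2 y ltac:(lra)). specialize (D3 y ltac:(lra)).
  apply Rabs_def2 in D1, D2, D3.
  unfold dist3, h; cbn [fst snd]. rewrite <- (sqrt_Rsqr eps) by lra.
  apply sqrt_lt_1_alt. unfold Rsqr.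
  split; [repeat apply Rplus_le_le_0_compat; apply pow2_ge_0|]. nra.
- intros x Hx. apply star_region in Hx as (s & rho & Hs & Hr & ->). rewrite Hh by auto.
  now apply sphere_map_sphere.
- intros p Hp. destruct (sphere_map_surj tau M T) with (p := p) as (s & rho & Hs & Hr & E); auto.
  exists (scale rho (border s)). rewrite Hh by auto. split; [|auto].
  apply star_region. now exists s, rho.
- intros E. apply star_region in H as (s & rho & Hs & Hr & ->).
  apply star_region in H0 as (s' & rho' & Hs' & Hr' & ->).
  rewrite !Hh in E by auto. apply sphere_map_fibre in E; auto.
  destruct E as [[-> ->]|[[<- <-]|[[<- E]|(-> & -> & E)]]].
  + replace (scale 0 (border s')) with (scale 0 (border s)) by (unfold scale; f_equal; ring).
    apply rst_refl.
  + apply rst_refl.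
  + pose proof (border_T k k_ge4) as BT.
    destruct E as [[-> ->]|[-> ->]]; rewrite BT; apply rst_refl.
  + rewrite !border_same by auto. now apply same_point_glued.
- intros E. apply glued_cases in E as [<-|(s & s' & Hs & Hs' & -> & -> & E)]; [reflexivity|].
  rewrite <- (border_same s), <- (border_same s'), !Hh by (auto; lra).
  now apply sphere_map_same_point.
Qed.
End OneTree.
End StarGluing.

(** * Angles and counting *)

Lemma face_angle_spec n v p :
  (exists i, (i < n)%nat /\ V n v i = p /\ face_angle n v p = interior_angle n v i) \/
  ((forall i, (i < n)%nat -> V n v i <> p) /\ face_angle n v p = PI).
Proof.
set (find := fix find (m : nat) : option nat :=
  match m with
  | O => None
  | S j => match find j with
           | Some i => Some i
           | None => if Req_dec_T (fst (V n v j)) (fst p) then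
                       if Req_dec_T (snd (V n v j)) (snd p) then Some j else None
                     else None
           end
  end).
assert (F : forall m, match find m with
   | Some i => (i < m)%nat /\ V n v i = p
   | None => forall i, (i < m)%nat -> V n v i <> p end).
{ induction m as [|m IH]; [simpl; intros; lia|].
  cbn [find]. destruct (find m) as [i|]; [split; [lia|tauto]|].
  destruct (Req_dec_T (fst (V n v m)) (fst p)) as [E1|N1];
    [destruct (Req_dec_T (snd (V n v m)) (snd p)) as [E2|N2]|].
  - split; [lia|]. rewrite (surjective_pairing p), <- E1, <- E2. apply surjective_pairing.
  - intros i Hi. destruct (Nat.eq_dec i m) as [->|Hne]; [congruence|apply IH; lia].
  - intros i Hi. destruct (Nat.eq_dec i m) as [->|Hne]; [congruence|apply IH; lia]. }
specialize (F n).
change (face_angle n v p) with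
  (match find n with Some i => interior_angle n v i | None => PI end).
destruct (find n) as [i|]; [left; exists i; tauto|right; tauto].
Qed.

(** Each point of [q] claims an entry of [L] that [b] maps to it. Distinct points claim distinct
    entries, and the unclaimed ones have nonnegative weight. *)
Lemma sum_le_of_cover {X : Type} (f : X -> R) (b : R -> X) (w : R -> R) (q : list X) (L : list R) :
  NoDup q -> (forall x, 0 <= w x) ->
  (forall x, In x q -> exists s, In s L /\ b s = x /\ f x <= w s) ->
  fold_right Rplus 0 (map f q) <= rtotal w L.
Proof.
intros Nd Hw. unfold rtotal. revert L; induction Nd as [|x q Hx Nd IH]; intros L H; cbn [map fold_right].
- clear H. induction L as [|s L IHL]; cbn [map fold_right]; [lra|]. specialize (Hw s). lra.
- destruct (H x) as (s & Hs & Es & Fs); [now left|].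
  apply in_split in Hs as (L1 & L2 & ->).
  assert (E : fold_right Rplus 0 (map w (L1 ++ s :: L2)) =
              w s + fold_right Rplus 0 (map w (L1 ++ L2))).
  { clear. induction L1 as [|r L1 IH]; cbn [app map fold_right]; [reflexivity|]. rewrite IH. ring. }
  rewrite E. specialize (IH (L1 ++ L2)).
  assert (fold_right Rplus 0 (map f q) <= fold_right Rplus 0 (map w (L1 ++ L2))); [|lra].
  apply IH. intros y Hy. destruct (H y) as (r & Hr & Er & Fr); [now right|].
  exists r. split; [|auto]. apply in_app_or in Hr. apply in_or_app.
  destruct Hr as [Hr|[<-|Hr]]; auto. exfalso; apply Hx. now rewrite <- Es, Er.
Qed.

Section Angles.
Variable k : nat.
Hypothesis k_ge4 : (4 <= k)%nat.

Notation n := (2 * k)%nat.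
Notation star := (star_vertex k).
Notation T := (INR (2 * n)).
Notation border := (border_point k).

(** The value [0] outside [[0, T]] lets the bounds below hold at every time of a given residue or
    parity, in the form required of caterpillar weights. *)
Definition border_angle (x : R) : R :=
  if Rle_dec 0 x then if Rle_dec x T then face_angle n star (border x) else 0 else 0.

Lemma border_angle_in x : 0 <= x <= T -> border_angle x = face_angle n star (border x).
Proof. intros H. unfold border_angle. repeat destruct Rle_dec; lra. Qed.

Lemma star_simple : simple_polygon n star.
Proof.
pose proof (edge_gt0 k k_ge4) as L.
assert (n0 : (0 < n)%nat) by lia.
pose proof (star_elen k k_ge4) as El.
split; [lia|split; [|split]].
- intros i _ C. pose proof (El i) as Ei. unfold elen in Ei. rewrite <- C in Ei.
  unfold Defs.dist in Ei. rewrite !Rminus_diag in Ei.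
  replace (0 ^ 2 + 0 ^ 2) with 0 in Ei by ring. rewrite sqrt_0 in Ei. lra.
- intros i _. now apply star_corner.
- intros s t Hs Ht E. rewrite <- (period_perimeter k k_ge4) in Hs, Ht.
  assert (Q : forall x, 0 <= x < sin (step k) / 2 * T -> 0 <= x / (sin (step k) / 2) < T).
  { intros x Hx. split; [apply Rmult_le_pos; [lra|left; apply Rinv_0_lt_compat; lra]|].
    apply (Rmult_lt_reg_r (sin (step k) / 2)); [lra|]. field_simplify; lra. }
  pose proof (Q s Hs). pose proof (Q t Ht).
  assert (P : forall x, gamma n star x = scale 1 (border (x / (sin (step k) / 2)))).
  { intros x. unfold border_point.
    replace (sin (step k) / 2 * (x / (sin (step k) / 2))) with x by (field; lra).
    unfold scale. rewrite !Rmult_1_l. apply surjective_pairing. }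
  rewrite !P in E. apply (border_ray_inj k k_ge4) in E; try lra.
  assert (Est : s / (sin (step k) / 2) = t / (sin (step k) / 2)) by lra.
  replace s with (s / (sin (step k) / 2) * (sin (step k) / 2)) by (field; lra).
  rewrite Est. field. lra.
Qed.

Lemma interior_angle_cases i :
  interior_angle n star i = if Nat.even i then 2 * PI - 3 * step k else step k.
Proof.
destruct (Nat.even i) eqn:H; [now apply interior_angle_even|now apply interior_angle_odd].
Qed.

(** The index runs up to [n] inclusive: time [T] is vertex [0] again, and as [n] is even the parity
    rule for the angle stays correct there. *)
Lemma border_face_angle x : 0 <= x <= T ->
  (exists i, (i <= n)%nat /\ x = INR (2 * i) /\
     face_angle n star (border x) = if Nat.even i then 2 * PI - 3 * step k else step k) \/
  ((forall i, (i <= n)%nat -> x <> INR (2 * i)) /\ face_angle n star (border x) = PI).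
Proof.
intros Hx. destruct (face_angle_spec n star (border x)) as [(i & Hi & Ei & Fi)|[Ni Fi]].
- left. rewrite interior_angle_cases in Fi.
  rewrite <- (border_vertex k k_ge4) in Ei by auto.
  pose proof (vertex_time k k_ge4 i Hi).
  rewrite <- (border_same k (INR (2 * i))), <- (border_same k x) in Ei by lra.
  apply (border_ray_inj k k_ge4) in Ei; try lra.
  assert (x = INR (2 * i) \/ (x = T /\ INR (2 * i) = 0)) as [E|[E1 E2]] by lra.
  + exists i. split; [lia|auto].
  + exists n. split; [lia|split; [auto|]]. apply (INR_eq _ 0) in E2.
    assert (i = 0)%nat as -> by lia. rewrite Nat.even_mul. exact Fi.
- right. split; [|exact Fi]. intros i Hi C. subst x.
  destruct (Nat.eq_dec i n) as [->|Hne].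
  + apply (Ni 0%nat); [lia|]. rewrite <- (border_vertex k k_ge4) by lia.
    rewrite (border_T k k_ge4). reflexivity.
  + apply (Ni i); [lia|]. rewrite (border_vertex k k_ge4); [reflexivity|lia].
Qed.

Lemma border_angle_ge0 x : 0 <= border_angle x.
Proof.
pose proof (step_bound k k_ge4). pose proof PI_RGT_0. unfold border_angle.
destruct Rle_dec; [|lra]. destruct Rle_dec; [|lra].
destruct (border_face_angle x) as [(i & _ & _ & ->)|[_ ->]]; [lra| |lra].
destruct Nat.even; lra.
Qed.

Lemma border_angle_flat x : (forall i, x <> INR (2 * i)) -> border_angle x <= 2 * PI / 2.
Proof.
intros H. pose proof PI_RGT_0. unfold border_angle.
destruct Rle_dec; [|lra]. destruct Rle_dec; [|lra].
destruct (border_face_angle x) as [(i & _ & C & _)|[_ ->]]; [lra| |lra].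
exfalso; exact (H _ C).
Qed.

Lemma border_angle_reflex j : (j mod 4 = 0)%nat -> border_angle (INR j) <= 2 * PI - 3 * step k.
Proof.
intros H. pose proof PI_RGT_0. pose proof (step_bound k k_ge4). unfold border_angle.
destruct Rle_dec; [|lra]. destruct Rle_dec; [|lra].
destruct (border_face_angle (INR j)) as [(i & _ & C & ->)|[_ ->]]; [lra| |lra].
destruct Nat.even; lra.
Qed.

Lemma border_angle_tip j : (j mod 4 = 2)%nat -> border_angle (INR j) <= step k.
Proof.
intros H. pose proof PI_RGT_0. pose proof (step_bound k k_ge4). unfold border_angle.
pose proof (Nat.div_mod_eq j 4) as D.
destruct Rle_dec; [|lra]. destruct Rle_dec as [L|]; [|lra].
destruct (border_face_angle (INR j)) as [(i & _ & C & ->)|[C ->]]; [lra| |].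
- apply INR_eq in C. destruct (Nat.even i) eqn:Ei; [|lra].
  apply Nat.even_spec in Ei as [x ->]. lia.
- exfalso. apply INR_le in L. apply (C (2 * (j / 4) + 1)%nat); [lia|f_equal; lia].
Qed.

(** The times [0] and [T] both visit the root and are one point of the polygon, so the first visit
    is dropped to count its angle once. Positive heights are covered by [same_point_class]. *)
Lemma tree_angle_condition t : size t = (2 * n)%nat ->
  inner_ok (2 * PI) (fun i => border_angle (INR i)) 0 t ->
  total (fun i => border_angle (INR i)) (tl (visits 0 t)) <= 2 * PI ->
  angle_condition n star (tree_gluing k t).
Proof.
intros St Hin Hroot p q Hp Nq Hq.
pose proof (period_gt0 k k_ge4) as T_pos.
apply (on_boundary_border k k_ge4) in Hp as (s & Hs & ->).
assert (Hq' : forall x, In x q -> exists s', 0 <= s' <= T /\ x = border s' /\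
   same_point (contour t) s s').
{ intros x Hx. apply (glued_border k k_ge4 t St s); auto. lra. }
assert (W : exists L, (forall s', 0 <= s' <= T -> same_point (contour t) s s' ->
    exists r, In r L /\ 0 <= r <= T /\ border r = border s') /\ rtotal border_angle L <= 2 * PI).
{ destruct (Req_dec (contour t s) 0) as [Z|Z].
  - exists (map INR (tl (visits 0 t))). split.
    2:{ unfold rtotal, total in *. now rewrite map_map. }
    assert (Tl : forall r, 0 < r <= T -> contour t r = 0 -> In r (map INR (tl (visits 0 t)))).
    { intros r Hr E. destruct (contour_zero_visits t 0 r) as (j & Hj & Ej); auto.
      { rewrite St. lra. }
      simpl (INR 0) in Ej. rewrite Rplus_0_l in Ej. subst r. apply in_map.
      destruct t; cbn [visits tl] in *; destruct Hj as [<-|Hj]; auto; simpl in Hr; lra. }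
    intros s' Hs' [E _]. rewrite Z in E. symmetry in E.
    destruct (Req_dec s' 0) as [->|Hne].
    (* The dropped time [0] is represented by [T]. *)
    + exists T. split; [|split; [lra|apply (border_T k k_ge4)]].
      apply Tl; [lra|]. apply contour_out. rewrite St. lra.
    + exists s'. split; [|auto]. apply Tl; auto; lra.
  - pose proof (contour_ge0 t s).
    destruct (same_point_class (2 * PI) border_angle t 0 s) as (L & HL & SL); auto.
    + intros x Hx. apply border_angle_flat. auto.
    + rewrite St. lra.
    + lra.
    + exists L. split; [|exact SL]. intros s' Hs' E. exists s'. split; [|auto].
      replace s' with (INR 0 + s') by (simpl; ring). apply HL; auto. now rewrite St. }
destruct W as (L & HL & SL). eapply Rle_trans; [|exact SL].
apply (sum_le_of_cover (face_angle n star) border border_angle); auto using border_angle_ge0.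
intros x Hx. destruct (Hq' x Hx) as (s' & Hs' & -> & E).
destruct (HL s' Hs' E) as (r & Hr & Rr & Er). exists r. split; [auto|split; [auto|]].
rewrite border_angle_in, Er by auto. lra.
Qed.
End Angles.

(** The node labelled by vertex [i] is also labelled by vertex [j] exactly when the two are glued,
    and an isomorphism of gluing trees preserves labels. *)
Lemma same_tree_vertices n v G1 G2 i j : (i < n)%nat -> (j < n)%nat ->
  on_boundary n v (V n v i) -> same_gluing_tree n v G1 G2 ->
  glued n v G1 (V n v i) (V n v j) <-> glued n v G2 (V n v i) (V n v j).
Proof.
intros Hi Hj Bi (phi & _ & _ & _ & Lab & _).
assert (Ni : is_node n v G1 (V n v i)).
{ split; [auto|]. right. exists i. split; [auto|apply rst_refl]. }
destruct (Lab _ Ni i Hi) as [[Li _] _]. destruct (Lab _ Ni j Hj) as [Lj _].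
assert (Pi : glued n v G2 (phi (V n v i)) (V n v i)) by (apply Li, rst_refl).
unfold label_vertex in Lj. rewrite Lj. split; intros H.
- apply rst_trans with (phi (V n v i)); [now apply rst_sym|auto].
- apply rst_trans with (V n v i); auto.
Qed.

(** * Binary words and the foldings they index *)

Fixpoint words (m : nat) : list (list bool) :=
  match m with
  | O => nil :: nil
  | S m' => map (cons true) (words m') ++ map (cons false) (words m')
  end.

Lemma words_length m : length (words m) = (2 ^ m)%nat.
Proof.
induction m as [|m IH]; [reflexivity|]. cbn [words]. rewrite length_app, !length_map, IH.
cbn [Nat.pow]. lia.
Qed.

Lemma in_words m w : In w (words m) -> length w = m.
Proof.
revert w; induction m as [|m IH]; cbn [words]; intros w H.
- destruct H as [<-|[]]. reflexivity.
- apply in_app_or in H as [H|H]; apply in_map_iff in H as (w' & <- & H);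
    cbn [length]; f_equal; auto.
Qed.

Lemma words_NoDup m : NoDup (words m).
Proof.
induction m as [|m IH]; cbn [words]; [repeat constructor; auto|].
apply NoDup_app.
- apply FinFun.Injective_map_NoDup; auto. intros x y E. congruence.
- apply FinFun.Injective_map_NoDup; auto. intros x y E. congruence.
- intros w H1 H2. apply in_map_iff in H1 as (x & <- & _).
  apply in_map_iff in H2 as (y & E & _). discriminate.
Qed.

Section Family.
Variables k m : nat.
Hypothesis k_ge4 : (4 <= k)%nat.
Hypothesis m_le : (6 * m < 2 * k)%nat.

Notation n := (2 * k)%nat.
Notation star := (star_vertex k).
Notation T := (INR (2 * n)).

(** The initial [Node Leaf] folds the first polygon edge in half, so that the caterpillar starts at
    time [2], a tip. The height of the innermost stem solves [2 + 2 * r + 12 * m = 4 * k]; it is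
    odd, as the fold about a midpoint requires. *)
Definition folding_tree (w : list bool) : tree :=
  Node Leaf (caterpillar (2 * k - 1 - 6 * m) w).

Lemma size_folding_tree w : length w = m -> size (folding_tree w) = (2 * n)%nat.
Proof. intros H. cbn [folding_tree size]. rewrite size_caterpillar. lia. Qed.

Lemma folding_aleksandrov w : length w = m ->
  aleksandrov_gluing n star (tree_gluing k (folding_tree w)).
Proof.
intros Hw. pose proof (size_folding_tree w Hw) as Sz.
split; [|split]; [now apply tree_is_gluing| |now apply tree_sphere_result].
pose proof (step_bound k k_ge4) as [S1 S2]. pose proof PI_RGT_0 as Pp.
assert (Odd : forall j, Nat.odd j = true -> border_angle k (INR j) <= 2 * PI / 2).
{ intros j Hj. apply border_angle_flat; auto. intros i C. apply INR_eq in C. subst j.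
  rewrite Nat.odd_mul in Hj. discriminate. }
destruct (caterpillar_ok (step k) (2 * PI - 3 * step k) (2 * PI) (fun i => border_angle k (INR i)))
  with (r := (2 * k - 1 - 6 * m)%nat) (bs := w) (o := 2%nat) as [I1 (L & EL & SL)]; auto; try lra.
- intros j. apply border_angle_reflex; auto.
- intros j. apply border_angle_tip; auto.
- apply Nat.odd_spec. exists (k - 1 - 3 * m)%nat. lia.
- apply tree_angle_condition; auto; unfold folding_tree.
  + change (total (fun i => border_angle k (INR i)) (1%nat :: nil) <= 2 * PI /\ True /\
      inner_ok (2 * PI) (fun i => border_angle k (INR i)) 2 (caterpillar (2 * k - 1 - 6 * m) w)).
    split; [|split; [exact I|exact I1]].
    unfold total; cbn [map fold_right]. specialize (Odd 1%nat eq_refl). lra.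
  + change (total (fun i => border_angle k (INR i)) (visits 2 (caterpillar (2 * k - 1 - 6 * m) w))
      <= 2 * PI).
    rewrite EL. unfold total in *; cbn [map fold_right].
    pose proof (border_angle_tip k k_ge4 2 eq_refl). lra.
Qed.

(** The tips [1 + 4 * i] and [3 + 4 * i] are at the contour times [2 + 8 * i] and [2 + 8 * i + 4],
    the start and the middle of the ascending part of block [i]. So the word can be read back from
    the gluing. *)
Lemma folding_block w i : length w = m -> (i < m)%nat ->
  (3 + 4 * i < n)%nat /\
  (glued n star (tree_gluing k (folding_tree w)) (V n star (1 + 4 * i)) (V n star (3 + 4 * i)) <->
   nth i w false = true).
Proof.
intros Hw Hi. pose proof (size_folding_tree w Hw) as Sz.
assert (Hi3 : (3 + 4 * i < n)%nat) by lia. split; [exact Hi3|].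
destruct (caterpillar_block (2 * k - 1 - 6 * m) w i) as (B1 & B2 & B3); [lia|].
pose proof (pos_INR i) as Pi.
assert (E1 : INR (2 * (1 + 4 * i)) = 2 + rsize Leaf + 8 * INR i).
{ rewrite mult_INR, plus_INR, mult_INR. simpl. ring. }
assert (E3 : INR (2 * (3 + 4 * i)) = 2 + rsize Leaf + (8 * INR i + 4)).
{ rewrite mult_INR, plus_INR, mult_INR. simpl. ring. }
pose proof (vertex_time k k_ge4 (1 + 4 * i) ltac:(lia)) as R1.
pose proof (vertex_time k k_ge4 (3 + 4 * i) ltac:(lia)) as R3.
rewrite <- !(border_vertex k k_ge4) by lia.
split.
- intros H. destruct (nth i w false) eqn:Hb; [reflexivity|exfalso].
  apply (glued_border k k_ge4 _ Sz) in H as (s' & Hs' & E & S); [|lra].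
  assert (S' : same_point (contour (folding_tree w)) (INR (2 * (1 + 4 * i))) (INR (2 * (3 + 4 * i)))).
  { apply same_point_trans with s'; auto. apply (border_eq_same_point k k_ge4 _ Sz); auto. lra. }
  rewrite E1, E3 in S'. apply same_point_next in S' as [S' _]; lra.
- intros Hb. apply (same_point_glued k k_ge4 _ Sz); try lra.
  rewrite E1, E3. apply same_point_next; try lra. now apply B2.
Qed.

Lemma foldings_distinct w w' : length w = m -> length w' = m -> w <> w' ->
  combinatorially_distinct n star (tree_gluing k (folding_tree w)) (tree_gluing k (folding_tree w')).
Proof.
intros Hw Hw' Hne Hs. apply Hne. apply (nth_ext w w' false false); [congruence|].
intros i Hi. rewrite Hw in Hi.
destruct (folding_block w i Hw Hi) as [L F]. destruct (folding_block w' i Hw' Hi) as [_ F'].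
assert (Bd : on_boundary n star (V n star (1 + 4 * i))).
{ apply (on_boundary_border k k_ge4). exists (INR (2 * (1 + 4 * i))).
  split; [apply vertex_time; auto; lia|]. rewrite (border_vertex k k_ge4); [reflexivity|lia]. }
pose proof (same_tree_vertices n star _ _ (1 + 4 * i) (3 + 4 * i) ltac:(lia) L Bd Hs) as Q.
destruct (nth i w false), (nth i w' false); intuition congruence.
Qed.
End Family.

Theorem theorem6 :
  exists c : R, 0 < c /\ exists N : nat,
    forall n : nat, (N <= n)%nat -> Nat.Even n ->
      exists v : nat -> pt, simple_polygon n v /\
        exists Gs : list gluing,
          (forall G, In G Gs -> aleksandrov_gluing n v G) /\
          (forall i j, (i < length Gs)%nat -> (j < length Gs)%nat -> i <> j ->
             combinatorially_distinct n v (nth i Gs nil) (nth j Gs nil)) /\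
          Rpower 2 (c * INR n) <= INR (length Gs).
Proof.
(* With [m] the integer part of [k / 4] and [k >= 4], one has [k <= 4 * m + 3 <= 8 * m], so
   [n / 16 = k / 8 <= m]. *)
exists (1 / 16). split; [lra|]. exists 8%nat. intros n Hn [k ->].
assert (Hk : (4 <= k)%nat) by lia.
pose proof (Nat.div_mod_eq k 4) as Dk. pose proof (Nat.mod_upper_bound k 4 ltac:(lia)) as Mk.
(* A block consumes six polygon edges, four on the way up and two on the way down, so [k / 4] blocks
   fit and leave edges for the final fold. *)
set (m := (k / 4)%nat) in *. assert (Hm : (6 * m < 2 * k)%nat) by lia.
exists (star_vertex k). split; [now apply star_simple|].
set (fold := fun w => tree_gluing k (folding_tree k m w)).
exists (map fold (words m)). split; [|split].
- intros G HG. apply in_map_iff in HG as (w & <- & Hw).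
  apply folding_aleksandrov; auto. now apply in_words.
- rewrite length_map. intros i j Hi Hj Hij.
  rewrite !(nth_indep _ nil (fold nil)) by now rewrite length_map.
  rewrite !map_nth. apply foldings_distinct; auto; try (apply in_words, nth_In; auto).
  intros E. apply Hij. apply (NoDup_nth (words m) nil); auto using words_NoDup.
- rewrite length_map, words_length, pow_INR. replace (INR 2) with 2 by (simpl; ring).
  rewrite <- (Rpower_pow m 2) by lra. apply Rle_Rpower; [lra|].
  rewrite mult_INR. simpl (INR 2).
  assert (INR k <= INR (8 * m)) as Q by (apply le_INR; lia).
  rewrite mult_INR in Q. replace (INR 8) with 8 in Q by (simpl; ring). lra.
Qed.
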